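(* Let $p$ be a prime, $d$ an odd prime with $p\equiv1\bmod d$, $a\in\mathbb{Z}$ with $1<a<d$, and $b:=d+1-a$. Let $X$ be the smooth projective model over $\mathbb{Q}_p$ of the affine curve $y^d=x^a(x-1)^b$. The formal power series $$l_1(X)=\sum_{k=0}^\infty\frac1{p^k}\binom{\frac{p^k-1}{d}b}{\frac{p^k-1}{d}}X^{p^k}$$ is the logarithm of a formal group over $\mathbb{Z}_p$, which is isomorphic to $\hat{J}_{X,1}/\mathbb{Z}_p$.
   Context: $X$ has genus $g=(d-1)/2$, good reduction at $p$, and a unique point $\infty$ not above the affine curve. Convention: $\binom00=1$. Let $\zeta_d\in\mathbb{Z}_p$ be a primitive $d$-th root of unity and $\delta$ the automorphism $(x,y)\mapsto(x,\zeta_dy)$ of $X$. Let $\hat{J}_X/\mathbb{Z}_p$ be the formal group of the Jacobian variety of $X$ (formal completion of its Néron model along the zero section). Definition of $\hat{J}_{X,i}$: embed the function field of $X$ in $\mathbb{Q}_p((\frac1T))$ by expanding at $\infty$ in the local parameter $\frac1T=x/y$ (so that $y=Tx$, and $\delta^*$ becomes $T\mapsto\zeta_dT$). Let $A\subset\mathbb{Q}_p((\frac1T))$ be the image of $H^0(X\setminus\{\infty\},\mathcal{O}_X)$ and let $1=\mu_1<\cdots<\mu_g$ be the Weierstrass gaps of $X$ at $\infty$, i.e. the $n\ge0$ with $H^0(X,\mathcal{O}_X(n\infty))=H^0(X,\mathcal{O}_X((n-1)\infty))$. Then $\mathbb{Q}_p((\frac1T))=A\oplus\frac1T\mathbb{Q}_p[[\frac1T]]\oplus\bigoplus_{i=1}^g\mathbb{Q}_pT^{\mu_i}$,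 and for each $k\ge0$ there are $e^{(k)}_{ii}\in\mathbb{Z}_p$ with $T^{\mu_ip^k}-e^{(k)}_{ii}T^{\mu_i}\in A\oplus\frac1T\mathbb{Q}_p[[\frac1T]]$. The series $\sum_{k\ge0}\frac{e_{ii}^{(k)}}{p^k}X^{p^k}$ is the logarithm of a one-dimensional formal group $\hat{J}_{X,i}$ over $\mathbb{Z}_p$, and $\hat{J}_X\cong\bigoplus_{i=1}^g\hat{J}_{X,i}$ as formal groups over $\mathbb{Z}_p$. *)

(* Defs.v *)
From HB Require Import structures.
From mathcomp Require Import all_boot all_order all_algebra.
From mathcomp Require Import boolp.
From mathcomp Require Import mpoly.

Set Implicit Arguments.
Unset Strict Implicit.
Unset Printing Implicit Defensive.

Import GRing.Theory.
Local Open Scope ring_scope.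

(* A commutative ring becomes a unit ring by choosing inverses classically. *)
Section ClassicalInverse.
Context (R : comNzRingType).

Definition cl_unit : pred R := fun x => `[< exists y, y * x = 1 >].

Definition cl_inv (x : R) : R :=
  match pselect (exists y, y * x = 1) with
  | left h => projT1 (cid h)
  | right _ => x
  end.

Fact cl_mulVr : {in cl_unit, left_inverse 1 cl_inv *%R}.
Proof.
move=> x /asboolP ux; rewrite /cl_inv; case: pselect => // h.
exact: (projT2 (cid h)).
Qed.

Fact cl_unitP (x y : R) : y * x = 1 -> cl_unit x.
Proof. by move=> yx1; apply/asboolP; exists y. Qed.

Fact cl_inv_out : {in [predC cl_unit], cl_inv =1 id}.
Proof.
move=> x; rewrite inE /= /cl_inv; case: pselect => // h.
by case/negP; apply/asboolP.
Qed.
End ClassicalInverse.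

(* The ring R[[X_1, ..., X_n]]: a series is its family of coefficients,
   indexed by exponent vectors. *)
Record mps (n : nat) (R : Type) := MPS { mps_coef :> 'X_{1..n} -> R }.

Section PowerSeriesRing.
Context (n : nat) (R : comNzRingType).
Implicit Types (f g h : mps n R) (m : 'X_{1..n}).

HB.instance Definition _ := gen_eqMixin (mps n R).
HB.instance Definition _ := gen_choiceMixin (mps n R).

Lemma mpsP f g : (forall m, f m = g m) -> f = g.
Proof. by case: f g => [f] [g] /= /funext ->. Qed.

Definition mps_add f g := MPS (fun m => f m + g m).
Definition mps_opp f := MPS (fun m => - f m).
Definition mpsC (c : R) : mps n R := MPS (fun m => if m == 0%MM then c else 0).
Definition mps_mul f g := MPS (fun m =>
  \sum_(k : 'X_{1..n < (mdeg m).+1, (mdeg m).+1} | m == (k.1 + k.2)%MM)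
     f k.1 * g k.2).

Fact mps_addA : associative mps_add.
Proof. by move=> f g h; apply: mpsP => m /=; rewrite addrA. Qed.
Fact mps_addC : commutative mps_add.
Proof. by move=> f g; apply: mpsP => m /=; rewrite addrC. Qed.
Fact mps_add0 : left_id (mpsC 0) mps_add.
Proof. by move=> f; apply: mpsP => m /=; case: eqP => _; rewrite add0r. Qed.
Fact mps_addN : left_inverse (mpsC 0) mps_opp mps_add.
Proof. by move=> f; apply: mpsP => m /=; case: eqP => _; rewrite addNr. Qed.

HB.instance Definition _ :=
  GRing.isZmodule.Build (mps n R) mps_addA mps_addC mps_add0 mps_addN.

Definition mps_trunc (d : nat) f : {mpoly R[n]} :=
  \sum_(m : 'X_{1..n < d}) f m *: 'X_[m].

Lemma mcoeff_trunc d f m : (mdeg m < d)%N -> (mps_trunc d f)@_m = f m.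
Proof. exact: mcoeff_mpoly. Qed.

Lemma mcoeff_truncM d f g m : (mdeg m < d)%N ->
  (mps_trunc d f * mps_trunc d g)@_m = mps_mul f g m.
Proof.
move=> md; rewrite mcoeffM; apply: eq_bigr => k _.
by rewrite !mcoeff_trunc // (leq_trans _ md) // bmdeg.
Qed.

Lemma mps_mulE f g m : mps_mul f g m =
  (mps_trunc (mdeg m).+1 f * mps_trunc (mdeg m).+1 g)@_m.
Proof. by rewrite mcoeff_truncM. Qed.

Lemma mcoeffM_eq (p p' q q' : {mpoly R[n]}) m :
    (forall k, (mdeg k <= mdeg m)%N -> p@_k = p'@_k) ->
    (forall k, (mdeg k <= mdeg m)%N -> q@_k = q'@_k) ->
  (p * q)@_m = (p' * q')@_m.
Proof.
move=> Hp Hq; rewrite !mcoeffM; apply: eq_bigr => k _.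
by rewrite Hp ?Hq // -ltnS bmdeg.
Qed.

Fact mps_mulA : associative mps_mul.
Proof.
move=> f g h; apply: mpsP => m; rewrite !mps_mulE.
set d := (mdeg m).+1.
transitivity ((mps_trunc d f * (mps_trunc d g * mps_trunc d h))@_m).
  apply: mcoeffM_eq => k km //.
  by rewrite mcoeff_trunc ?ltnS // mcoeff_truncM ?ltnS.
rewrite mulrA; apply: mcoeffM_eq => k km //.
by rewrite mcoeff_trunc ?ltnS // mcoeff_truncM ?ltnS.
Qed.

Fact mps_mulC : commutative mps_mul.
Proof. by move=> f g; apply: mpsP => m; rewrite !mps_mulE mulrC. Qed.

Fact mps_mul1 : left_id (mpsC 1) mps_mul.
Proof.
move=> f; apply: mpsP => m; rewrite mps_mulE.
rewrite (@mcoeffM_eq _ 1 _ (mps_trunc (mdeg m).+1 f)) //.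
  by rewrite mul1r mcoeff_trunc.
move=> k km; rewrite mcoeff_trunc ?ltnS //= mcoeff1.
by case: eqP.
Qed.

Fact mps_mulDl : left_distributive mps_mul +%R.
Proof.
move=> f g h; apply: mpsP => m /=; rewrite -big_split /=.
by apply: eq_bigr => k _; rewrite mulrDl.
Qed.

Fact mps_oner_neq0 : mpsC 1 != 0.
Proof.
apply/eqP => /(congr1 (fun f : mps n R => f 0%MM)) /=.
by rewrite eqxx; apply/eqP; rewrite oner_neq0.
Qed.

HB.instance Definition _ := GRing.Zmodule_isComNzRing.Build (mps n R)
  mps_mulA mps_mulC mps_mul1 mps_mulDl mps_oner_neq0.

HB.instance Definition _ := GRing.ComNzRing_hasMulInverse.Build (mps n R)
  (@cl_mulVr (mps n R)) (@cl_unitP (mps n R)) (@cl_inv_out (mps n R)).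
End PowerSeriesRing.

Section PowerSeriesDomain.
Context (n : nat) (R : idomainType).
Implicit Types (f g : mps n R) (m : 'X_{1..n}).

Lemma mps0E m : (0 : mps n R) m = 0.
Proof. by rewrite /=; case: eqP. Qed.

Lemma mps_low f : f != 0 -> exists D : nat,
  (forall m, (mdeg m < D)%N -> f m = 0) /\ mps_trunc D.+1 f != 0.
Proof.
move=> f0.
have [m fm] : exists m, f m != 0.
  apply: contrapT => H; case/negP: f0; apply/eqP/mpsP => m.
  rewrite mps0E.
  by apply: contrapT => /eqP fm; apply: H; exists m.
have exD : exists D, `[< exists m, f m != 0 /\ mdeg m = D >].
  by exists (mdeg m); apply/asboolP; exists m.
case: (ex_minnP exD) => D /asboolP [k [fk kD]] minD; exists D; split.
  move=> l lD; apply: contrapT => /eqP fl; move: lD; rewrite ltnNge.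
  by rewrite minD //; apply/asboolP; exists l.
apply: contraNneq fk => /(congr1 (mcoeff k)).
by rewrite mcoeff_trunc ?kD // mcoeff0 => ->.
Qed.

Fact mps_mulf_eq0 : GRing.integral_domain_axiom (mps n R).
Proof.
move=> f g fg0; apply: contrapT => /negP.
rewrite negb_or => /andP [/mps_low [D [fD PD]] /mps_low [E [gE QE]]].
have : mps_trunc D.+1 f * mps_trunc E.+1 g != 0 by rewrite mulf_neq0.
set P := mps_trunc _ f; set Q := mps_trunc _ g => PQ.
have hP k : P@_k != 0 -> mdeg k = D.
  case: (ltngtP (mdeg k) D) => // kD.
    by rewrite mcoeff_trunc ?fD ?eqxx // ltnS ltnW.
  rewrite raddf_sum /= big1 ?eqxx // => i _; rewrite mcoeffZ mcoeffX.
  case: eqP => [ik|]; last by rewrite mulr0.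
  by move: kD; rewrite -ik leqNgt bmdeg.
have hQ k : Q@_k != 0 -> mdeg k = E.
  case: (ltngtP (mdeg k) E) => // kD.
    by rewrite mcoeff_trunc ?gE ?eqxx // ltnS ltnW.
  rewrite raddf_sum /= big1 ?eqxx // => i _; rewrite mcoeffZ mcoeffX.
  case: eqP => [ik|]; last by rewrite mulr0.
  by move: kD; rewrite -ik leqNgt bmdeg.
have [m PQm] : exists m, (P * Q)@_m <> 0.
  apply: contrapT => H; move/eqP: PQ; apply; apply/mpolyP => m.
  by rewrite mcoeff0; apply: contrapT => ?; apply: H; exists m.
have mDE : mdeg m = (D + E)%N.
  apply: contrapT => mDE; apply: PQm; rewrite mcoeffM.
  apply: big1 => k /eqP mk; apply: contrapT => /eqP.
  rewrite mulf_eq0 negb_or => /andP [/hP kD /hQ kE].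
  by apply: mDE; rewrite mk mdegD kD kE.
apply: PQm.
have := congr1 (fun h : mps n R => h m) fg0.
rewrite mps0E => <-; rewrite mcoeffM; apply: eq_bigr => k /eqP mk.
have {mk}mDE : (mdeg k.1 + mdeg k.2)%N = (D + E)%N by rewrite -mdegD -mk.
move: k mDE => [[k1 /= _] [k2 /= _]] /= mDE.
case: (ltngtP (mdeg k1) D) => kD.
- rewrite fD // mul0r; case: (P@_k1 =P 0) => [->|/eqP/hP e]; first by rewrite mul0r.
  by rewrite e ltnn in kD.
- have kE : (mdeg k2 < E)%N.
    by rewrite ltnNge; apply/negP => EE; have := leq_add kD EE; rewrite addSn mDE ltnn.
  rewrite gE // mulr0; case: (Q@_k2 =P 0) => [->|/eqP/hQ e]; first by rewrite mulr0.
  by rewrite e ltnn in kE.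
- move/eqP: mDE; rewrite kD eqn_add2l => /eqP kE.
  by rewrite !mcoeff_trunc ?kD ?kE.
Qed.

HB.instance Definition _ :=
  GRing.ComUnitRing_isIntegral.Build (mps n R) mps_mulf_eq0.
End PowerSeriesDomain.

(* Z_p as the inverse limit of the rings Z/p^n, n >= 1.  The (unused) primality
   proof keeps the ring structures, which need it, attached to the type. *)
Definition padic_compat (p : nat) (x : forall n, 'Z_(p ^ n.+1)) : Prop :=
  forall n, (x n.+1 : nat) = x n %[mod p ^ n.+1].

Record padic_int (p : nat) (p_pr : prime p) := Padic {
  padic_res :> forall n, 'Z_(p ^ n.+1);
  padic_resP : padic_compat padic_res }.

Section PadicRing.
Context (p : nat) (p_pr : prime p).
Local Notation Zp := (padic_int p_pr).
Implicit Types x y z : Zp.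

HB.instance Definition _ := gen_eqMixin Zp.
HB.instance Definition _ := gen_choiceMixin Zp.

Lemma padicP x y : (forall n, x n = y n) -> x = y.
Proof.
case: x y => [x Hx] [y Hy] /= H.
have E : x = y by apply: functional_extensionality_dep.
by move: Hx; rewrite E => Hx; rewrite (Prop_irrelevance Hx Hy).
Qed.

Lemma pexp_gt1 n : (1 < p ^ n.+1)%N.
Proof. by rewrite -(exp1n n.+1) ltn_exp2r // prime_gt1. Qed.

Lemma Zp_truncE n : (Zp_trunc (p ^ n.+1)).+2 = (p ^ n.+1)%N.
Proof. exact: Zp_cast (pexp_gt1 n). Qed.

Lemma val_ZpD n (x y : 'Z_(p ^ n.+1)) : (x + y)%R = ((x + y) %% p ^ n.+1)%N :> nat.
Proof. by congr (_ %% _)%N; apply: Zp_truncE. Qed.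
Lemma val_ZpM n (x y : 'Z_(p ^ n.+1)) : (x * y)%R = ((x * y) %% p ^ n.+1)%N :> nat.
Proof. by congr (_ %% _)%N; apply: Zp_truncE. Qed.
Lemma val_ZpN n (x : 'Z_(p ^ n.+1)) : (- x)%R = ((p ^ n.+1 - x) %% p ^ n.+1)%N :> nat.
Proof.
have -> : (- x)%R = (((Zp_trunc (p ^ n.+1)).+2 - x) %% (Zp_trunc (p ^ n.+1)).+2)%N :> nat by [].
by congr ((_ - _) %% _)%N; apply: Zp_truncE.
Qed.
Lemma ltn_Zp n (x : 'Z_(p ^ n.+1)) : (x < p ^ n.+1)%N.
Proof. by apply: leq_trans (ltn_ord x) _; rewrite Zp_truncE. Qed.

Lemma pdv n : (p ^ n.+1 %| p ^ n.+2)%N. Proof. exact: dvdn_exp2l. Qed.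

Lemma padic_modS n k : k %% p ^ n.+2 = k %[mod p ^ n.+1].
Proof. exact: modn_dvdm (pdv n). Qed.

Fact padic_compat_add x y : padic_compat (fun n => x n + y n).
Proof.
move=> n; rewrite !val_ZpD padic_modS modn_mod.
by rewrite -modnDm !(padic_resP _ n) modnDm.
Qed.
Fact padic_compat_mul x y : padic_compat (fun n => x n * y n).
Proof.
move=> n; rewrite !val_ZpM padic_modS modn_mod.
by rewrite -modnMm !(padic_resP _ n) modnMm.
Qed.
Fact padic_compat_nat k : padic_compat (fun n => k%:R : 'Z_(p ^ n.+1)).
Proof.
by move=> n; rewrite !val_Zp_nat ?pexp_gt1 // padic_modS modn_mod.
Qed.
Fact padic_compat_opp x : padic_compat (fun n => - x n).
Proof.
move=> n; rewrite !val_ZpN padic_modS modn_mod.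
have l k (z : 'Z_(p ^ k.+1)) : (z <= p ^ k.+1)%N by rewrite ltnW ?ltn_Zp.
apply/eqP; rewrite -(eqn_modDr (x n)) subnK //.
rewrite -modnDmr -(padic_resP x n) modnDmr subnK // modnn.
by apply/eqP/eqP; rewrite -/(dvdn _ _) pdv.
Qed.

Definition padic_add x y : Zp := Padic p_pr (padic_compat_add x y).
Definition padic_mul x y : Zp := Padic p_pr (padic_compat_mul x y).
Definition padic_opp x : Zp := Padic p_pr (padic_compat_opp x).
Definition padic_nat k : Zp := Padic p_pr (padic_compat_nat k).

Fact padic_addA : associative padic_add.
Proof. by move=> x y z; apply: padicP => n /=; apply: addrA. Qed.
Fact padic_addC : commutative padic_add.
Proof. by move=> x y; apply: padicP => n /=; apply: addrC. Qed.
Fact padic_add0 : left_id (padic_nat 0) padic_add.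
Proof. by move=> x; apply: padicP => n /=; apply: add0r. Qed.
Fact padic_addN : left_inverse (padic_nat 0) padic_opp padic_add.
Proof. by move=> x; apply: padicP => n /=; apply: addNr. Qed.

HB.instance Definition _ :=
  GRing.isZmodule.Build Zp padic_addA padic_addC padic_add0 padic_addN.

Fact padic_mulA : associative padic_mul.
Proof. by move=> x y z; apply: padicP => n /=; apply: mulrA. Qed.
Fact padic_mulC : commutative padic_mul.
Proof. by move=> x y; apply: padicP => n /=; apply: mulrC. Qed.
Fact padic_mul1 : left_id (padic_nat 1) padic_mul.
Proof. by move=> x; apply: padicP => n /=; apply: mul1r. Qed.
Fact padic_mulDl : left_distributive padic_mul +%R.
Proof. by move=> x y z; apply: padicP => n /=; apply: mulrDl. Qed.
Fact padic_oner_neq0 : padic_nat 1 != 0.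
Proof.
apply/eqP => /(congr1 (fun x : Zp => x 0)) /= /eqP.
by rewrite oner_eq0.
Qed.

HB.instance Definition _ := GRing.Zmodule_isComNzRing.Build Zp
  padic_mulA padic_mulC padic_mul1 padic_mulDl padic_oner_neq0.

HB.instance Definition _ := GRing.ComNzRing_hasMulInverse.Build Zp
  (@cl_mulVr Zp) (@cl_unitP Zp) (@cl_inv_out Zp).

Lemma padic_res_mod x n k : x (n + k)%N = x n %[mod p ^ n.+1].
Proof.
elim: k => [|k IH]; first by rewrite addn0.
rewrite addnS -IH.
have d : (p ^ n.+1 %| p ^ (n + k).+1)%N by rewrite dvdn_exp2l // ltnS leq_addr.
by rewrite -(modn_dvdm _ d) (padic_resP x) (modn_dvdm _ d).
Qed.

Lemma padic_neq0 x : x != 0 ->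
  exists n, forall k, ~~ (p ^ n.+1 %| x (n + k)%N)%N.
Proof.
move=> x0; have [n xn] : exists n, x n != 0.
  apply: contrapT => H; case/negP: x0; apply/eqP/padicP => n.
  by apply: contrapT => /eqP xn; apply: H; exists n.
exists n => k; rewrite /dvdn padic_res_mod; apply: contra xn => /eqP H.
apply/eqP/val_inj => /=; rewrite -H modn_small ?ltn_Zp //.
Qed.

Fact padic_mulf_eq0 : GRing.integral_domain_axiom Zp.
Proof.
move=> x y xy0; apply: contrapT => /negP.
rewrite negb_or => /andP [/padic_neq0 [n xn] /padic_neq0 [m ym]].
have : (p ^ (n + m).+1 %| x (n + m)%N * y (n + m)%N)%N.
  have := congr1 (fun z : Zp => nat_of_ord (z (n + m)%N)) xy0.
  by rewrite val_ZpM /dvdn => ->; rewrite val_Zp_nat ?pexp_gt1 ?mod0n.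
move: (xn m) (ym n); rewrite (addnC m n).
move: (nat_of_ord (x _)) (nat_of_ord (y _)) => X Y Xn Ym XY.
have X0 : (0 < X)%N by rewrite lt0n; apply: contraNneq Xn => ->; rewrite dvdn0.
have Y0 : (0 < Y)%N by rewrite lt0n; apply: contraNneq Ym => ->; rewrite dvdn0.
move: Xn Ym XY; rewrite !pfactor_dvdn ?muln_gt0 ?X0 ?Y0 //.
rewrite lognM // -!leqNgt => Xn Ym; rewrite ltnNge.
by case/negP; apply: leq_add.
Qed.

HB.instance Definition _ := GRing.ComUnitRing_isIntegral.Build Zp padic_mulf_eq0.
End PadicRing.

Definition padic_num (p : nat) (p_pr : prime p) : fieldType :=
  {fraction (padic_int p_pr)}.

Section FormalGroups.

Definition mpsX (n : nat) (R : comNzRingType) (i : 'I_n) : mps n R :=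
  MPS (fun m => (m == U_(i)%MM)%:R).

Definition mps_map (n : nat) (R S : Type) (u : R -> S) (f : mps n R) : mps n S :=
  MPS (fun m => u (f m)).

(* f(g_1, ..., g_n), meaningful when the g_j have zero constant term: then
   g^i has no term of total degree < |i|, so only |i| <= |m| contributes to
   the coefficient at m. *)
Definition mps_subst (n k : nat) (R : comNzRingType)
    (f : mps n R) (g : n.-tuple (mps k R)) : mps k R :=
  MPS (fun m => \sum_(i : 'X_{1..n < (mdeg m).+1})
                   f i * (\prod_(j < n) tnth g j ^+ (i : 'X_{1..n}) j) m).

(* One-dimensional commutative formal group laws; the zero constant term
   follows from L(X, 0) = X. *)
Definition formal_group_law (R : comNzRingType) (L : mps 2 R) : Prop :=
  let X1 : mps 1 R := mpsX R 0 in
  let X2 : mps 2 R := mpsX R 0 in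
  let Y2 : mps 2 R := mpsX R 1 in
  let X3 : mps 3 R := mpsX R 0 in
  let Y3 : mps 3 R := mpsX R 1 in
  let Z3 : mps 3 R := mpsX R 2 in
  [/\ mps_subst L [tuple X1; 0] = X1,
      mps_subst L [tuple 0; X1] = X1,
      mps_subst L [tuple mps_subst L [tuple X3; Y3]; Z3]
        = mps_subst L [tuple X3; mps_subst L [tuple Y3; Z3]]
    & mps_subst L [tuple Y2; X2] = L].

Definition formal_group_iso (R : comUnitRingType) (L M : mps 2 R) : Prop :=
  exists phi : mps 1 R,
    [/\ phi 0%MM = 0, phi U_(ord0)%MM \is a GRing.unit
      & mps_subst phi [tuple L]
        = mps_subst M [tuple mps_subst phi [tuple mpsX R (0 : 'I_2)];
                             mps_subst phi [tuple mpsX R (1 : 'I_2)]]].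

(* l(X) = X + O(X^2) over Frac R, with l(L(X, Y)) = l(X) + l(Y). *)
Definition is_logarithm (R : idomainType) (L : mps 2 R)
    (l : mps 1 {fraction R}) : Prop :=
  [/\ l 0%MM = 0, l U_(ord0)%MM = 1
    & mps_subst l [tuple mps_map (@tofrac R) L]
      = mps_subst l [tuple mpsX {fraction R} (0 : 'I_2)]
        + mps_subst l [tuple mpsX {fraction R} (1 : 'I_2)]].

(* \sum_(k >= 0) (c k / p^k) X^(p^k).  As k < p^k, the coefficient of X^n
   only involves k <= n. *)
Definition p_power_series (p : nat) (K : fieldType) (c : nat -> K) : mps 1 K :=
  MPS (fun m => \sum_(k < (m ord0).+1 | (p ^ k)%N == m ord0) c k / p%:R ^+ k).

End FormalGroups.

(* K((1/T)) as the fraction field of K[[z]], where z = 1/T. *)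
Section Laurent.
Context (K : fieldType).

Definition laurent : fieldType := {fraction (mps 1 K)}.

Definition laurentC (r : K) : laurent := tofrac (mpsC 1 r).

Definition laurentT : laurent := (tofrac (mpsX K ord0))^-1.

End Laurent.

Section Curve.
Context (K F : fieldType) (c : {rmorphism K -> F}) (x y : F).

(* P(x, y) in F, for P in K[x][y]. *)
Definition eval_xy (P : {poly {poly K}}) : F :=
  (map_poly (fun q : {poly K} => (map_poly c q).[x]) P).[y].

(* y^d - x^a (x - 1)^b in K[x][y]. *)
Definition curve_poly (a b d : nat) : {poly {poly K}} :=
  'X^d - ('X^a * ('X - 1) ^+ b)%:P.

(* F is the fraction field of K[x, y] / (y^d - x^a (x - 1)^b). *)
Definition is_function_field (a b d : nat) : Prop :=
  (forall P, eval_xy P = 0 <-> exists Q, P = Q * curve_poly a b d) /\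
  (forall f, exists P Q, eval_xy Q != 0 /\ f = eval_xy P / eval_xy Q).

(* The closed points of the smooth projective model X of F / K, given by their
   local rings: the nontrivial valuation rings of F / K. *)
Definition closed_point (O : F -> Prop) : Prop :=
  [/\ forall r, O (c r),
      forall f g, O f -> O g -> O (f - g) /\ O (f * g),
      forall f, f != 0 -> O f \/ O f^-1
    & exists f, ~ O f].

Context (iota : {rmorphism F -> laurent K}).

(* The local ring at the point whose completed local field is given by iota. *)
Definition local_ring_infty (f : F) : Prop :=
  exists g : mps 1 K, iota f = tofrac g.

(* iota is the expansion at infinity in the parameter 1/T = x/y.  The last
   clause is needed: for a = d - 1, x/y is also a local parameter at the point
   above (0, 0); infinity is the point where x has a pole. *)
Definition expansion_at_infty : Prop :=
  [/\ forall r, iota (c r) = laurentC r,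
      iota y = laurentT K * iota x
    & ~ local_ring_infty x].

(* H^0(X \ {infty}, O_X). *)
Definition regular_off_infty (f : F) : Prop :=
  forall O, closed_point O -> ~ (forall h, O h <-> local_ring_infty h) -> O f.

(* H^0(X, O_X(n infty)). *)
Definition global_sections (n : int) (f : F) : Prop :=
  regular_off_infty f /\
  exists g : mps 1 K, iota f = laurentT K ^ n * tofrac g.

Definition weierstrass_gap (n : nat) : Prop :=
  forall f, global_sections n%:Z f <-> global_sections (n%:Z - 1) f.

(* mu is the i-th smallest gap mu_i, for i >= 1. *)
Definition nth_gap (i mu : nat) : Prop :=
  weierstrass_gap mu /\ (\sum_(n < mu.+1) `[< weierstrass_gap n >] = i)%N.

(* s lies in A + (1/T) K[[1/T]]. *)
Definition in_A_plus_principal (s : laurent K) : Prop :=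
  exists f (g : mps 1 K),
    regular_off_infty f /\ s = iota f + (laurentT K)^-1 * tofrac g.

End Curve.

(* J is the formal group \hat J_{X,i} over Z_p; F, c, iota are as above with
   K = Q_p. *)
Definition is_hatJ (p : nat) (p_pr : prime p) (F : fieldType)
    (c : {rmorphism padic_num p_pr -> F})
    (iota : {rmorphism F -> laurent (padic_num p_pr)})
    (i : nat) (J : mps 2 (padic_int p_pr)) : Prop :=
  let T := laurentT (padic_num p_pr) in
  exists (mu : nat) (e : nat -> padic_int p_pr),
    [/\ nth_gap c iota i mu,
        forall k, in_A_plus_principal c iota
          (T ^+ (mu * p ^ k) - laurentC (tofrac (e k)) * T ^+ mu),
        formal_group_law J
      & is_logarithm J (p_power_series p (fun k => tofrac (e k)))].

Definition l1 (p : nat) (p_pr : prime p) (b d : nat) : mps 1 (padic_num p_pr) :=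
  p_power_series p (fun k =>
    ('C((p ^ k - 1) %/ d * b, (p ^ k - 1) %/ d))%N%:R).

(* Main.v *)
(* Put n_k = (p^k - 1) / d.  On the curve T^d = x (1 - 1/x)^b, hence
   T^(p^k) = T x^(n_k) (1 - 1/x)^(b n_k), whose T-coefficient modulo regular
   functions and (1/T) K[[1/T]] is (-1)^(n_k) binom(b n_k, n_k); n_k is even because
   p and d are odd.  These coefficients are well defined because 1 is a gap: a
   function whose only pole is a simple one at infinity would give polynomials with
   psi^d = phi^a (phi - 1)^b, which a degree count on phi' excludes.  So the logarithm
   of \hat J_{X,1} is l_1 itself.

   For integrality, the ratios binom(b n_(k+1), n_(k+1)) / binom(b n_k, n_k) are
   quotients of values of the p-adic Gamma function and converge to some u in Z_p
   with l_1(X) - (u/p) l_1(X^p) in Z_p[[X]]; the functional equation lemma then gives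
   a formal group law over Z_p with logarithm l_1. *)
Require Import Defs.
From HB Require Import structures.
From mathcomp Require Import all_boot all_order all_algebra.
From mathcomp Require Import boolp.
From mathcomp Require Import mpoly.
From mathcomp Require classical_sets.
From mathcomp Require Import ring zify.

Set Implicit Arguments.
Unset Strict Implicit.
Unset Printing Implicit Defensive.

Import GRing.Theory.
Local Open Scope ring_scope.

(** * Orders and substitution of power series *)

Section SeriesOrder.
Context (n : nat) (R : comNzRingType).
Implicit Types (f g : mps n R) (m : 'X_{1..n}) (N : nat).

Lemma mps_coef0 m : (0 : mps n R) m = 0.
Proof. by rewrite /=; case: eqP. Qed.

Lemma mps_coef1 m : (1 : mps n R) m = (m == 0%MM)%:R.
Proof. by rewrite /=; case: eqP. Qed.

Lemma mps_coefD f g m : (f + g) m = f m + g m.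
Proof. by []. Qed.

Lemma mps_coefB f g m : (f - g) m = f m - g m.
Proof. by []. Qed.

Lemma mps_coef_sum I (r : seq I) (P : pred I) (F : I -> mps n R) m :
  (\sum_(i <- r | P i) F i) m = \sum_(i <- r | P i) F i m.
Proof.
elim/big_rec2: _ => [|i x y _ <- //]; exact: mps_coef0.
Qed.

Lemma mps_coefM f g m (p q : {mpoly R[n]}) :
    (forall k, (mdeg k <= mdeg m)%N -> p@_k = f k) ->
    (forall k, (mdeg k <= mdeg m)%N -> q@_k = g k) ->
  (f * g) m = (p * q)@_m.
Proof.
move=> Hp Hq; have -> : (f * g) m = mps_mul f g m by [].
rewrite mps_mulE; apply: mcoeffM_eq => k km.
  by rewrite mcoeff_trunc ?ltnS ?Hp.
by rewrite mcoeff_trunc ?ltnS ?Hq.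
Qed.

Lemma mps_coefM0 f g : (f * g) 0%MM = f 0%MM * g 0%MM.
Proof.
rewrite (@mps_coefM f g 0%MM (f 0%MM)%:MP (g 0%MM)%:MP).
- by rewrite -mpolyCM mcoeffC eqxx mulr1.
- by move=> k; rewrite mdeg0 leqn0 mdeg_eq0 => /eqP ->; rewrite mcoeffC eqxx mulr1.
- by move=> k; rewrite mdeg0 leqn0 mdeg_eq0 => /eqP ->; rewrite mcoeffC eqxx mulr1.
Qed.

Lemma mps_coefX0 f N : (f ^+ N) 0%MM = f 0%MM ^+ N.
Proof.
by elim: N => [|N IH]; rewrite ?expr0 ?mps_coef1 ?eqxx // !exprS mps_coefM0 IH.
Qed.

Fact mpsC_is_zmod_morphism : zmod_morphism (@mpsC n R).
Proof.
by move=> x y; apply: mpsP => m /=; case: ifP; rewrite ?subr0.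
Qed.

Lemma mpsC_mulE (c : R) f m : (mpsC n c * f) m = c * f m.
Proof.
rewrite (@mps_coefM (mpsC n c) f m c%:MP (mps_trunc (mdeg m).+1 f)).
- by rewrite mul_mpolyC mcoeffZ mcoeff_trunc.
- by move=> k _; rewrite mcoeffC /=; case: eqP; rewrite (mulr1, mulr0).
- by move=> k km; rewrite mcoeff_trunc.
Qed.

Fact mpsC_is_monoid_morphism : monoid_morphism (@mpsC n R).
Proof.
split=> // x y; apply: mpsP => m; rewrite mpsC_mulE /=.
by case: ifP; rewrite ?mulr0.
Qed.

HB.instance Definition _ :=
  GRing.isZmodMorphism.Build R (mps n R) (@mpsC n R) mpsC_is_zmod_morphism.
HB.instance Definition _ :=
  GRing.isMonoidMorphism.Build R (mps n R) (@mpsC n R) mpsC_is_monoid_morphism.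

Definition mps_ordge N f := forall m, (mdeg m < N)%N -> f m = 0.

Lemma ordge0 N : mps_ordge N 0.
Proof. by move=> m _; rewrite mps_coef0. Qed.

Lemma ordge_coef0 f : mps_ordge 1 f <-> f 0%MM = 0.
Proof.
split=> [|f0 m]; first by apply; rewrite mdeg0.
by rewrite ltnS leqn0 mdeg_eq0 => /eqP ->.
Qed.

Lemma ordgeW N M f : (M <= N)%N -> mps_ordge N f -> mps_ordge M f.
Proof. by move=> MN H m mM; apply: H; apply: leq_trans MN. Qed.

Lemma ordgeD N f g : mps_ordge N f -> mps_ordge N g -> mps_ordge N (f + g).
Proof. by move=> Hf Hg m mN /=; rewrite Hf ?Hg ?addr0. Qed.

Lemma ordgeN N f : mps_ordge N f -> mps_ordge N (- f).
Proof. by move=> Hf m mN /=; rewrite Hf ?oppr0. Qed.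

Lemma ordgeB N f g : mps_ordge N f -> mps_ordge N g -> mps_ordge N (f - g).
Proof. by move=> Hf /ordgeN; apply: ordgeD. Qed.

Lemma ordgeBC N f g : mps_ordge N (f - g) -> mps_ordge N (g - f).
Proof. by move/ordgeN; rewrite opprB. Qed.

Lemma ordge_trans N f g h :
  mps_ordge N (f - g) -> mps_ordge N (g - h) -> mps_ordge N (f - h).
Proof. by move=> H1 H2; move: (ordgeD H1 H2); rewrite addrA subrK. Qed.

Lemma ordge_sum N I (r : seq I) (P : pred I) (F : I -> mps n R) :
  (forall i, P i -> mps_ordge N (F i)) -> mps_ordge N (\sum_(i <- r | P i) F i).
Proof.
by move=> H; elim/big_rec: _ => [|i x Pi]; [exact: ordge0|apply: ordgeD; apply: H].
Qed.

Lemma ordgeM M N f g : mps_ordge M f -> mps_ordge N g -> mps_ordge (M + N) (f * g).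
Proof.
move=> Hf Hg m mMN; apply: big1 => -[k1 k2] /= /eqP E.
have: (mdeg k1 + mdeg k2 < M + N)%N by rewrite -mdegD -E.
case: (ltnP (mdeg k1) M) => k1M; first by rewrite Hf ?mul0r.
case: (ltnP (mdeg k2) N) => k2N; first by rewrite Hg ?mulr0.
by rewrite ltnNge leq_add.
Qed.

Lemma ordgeMr N f g : mps_ordge N f -> mps_ordge N (f * g).
Proof. by move=> Hf; rewrite -[N]addn0; apply: ordgeM. Qed.

Lemma ordgeMl N f g : mps_ordge N g -> mps_ordge N (f * g).
Proof. by rewrite mulrC; apply: ordgeMr. Qed.

Lemma ordgeX N f k : mps_ordge N f -> mps_ordge (N * k) (f ^+ k).
Proof.
move=> Hf; elim: k => [|k IH]; first by rewrite muln0.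
by rewrite mulnS exprS; apply: ordgeM.
Qed.

Lemma ordge_eq N f g m : mps_ordge N (f - g) -> (mdeg m < N)%N -> f m = g m.
Proof. by move=> H /H /=/eqP; rewrite subr_eq0 => /eqP. Qed.

Lemma eq_ordge N f g : (forall m, (mdeg m < N)%N -> f m = g m) -> mps_ordge N (f - g).
Proof. by move=> H m mN /=; rewrite H ?subrr. Qed.

Lemma ordge_ext f g : (forall N, mps_ordge N (f - g)) -> f = g.
Proof. by move=> H; apply: mpsP => m; apply: ordge_eq (H (mdeg m).+1) _. Qed.

Lemma ordge_mulB N f f' g g' : mps_ordge N (f - f') -> mps_ordge N (g - g') ->
  mps_ordge N (f * g - f' * g').
Proof.
move=> Hf Hg; have -> : f * g - f' * g' = (f - f') * g + f' * (g - g') by ring.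
by apply: ordgeD; [apply: ordgeMr|apply: ordgeMl].
Qed.

Lemma ordge_expB N f g k : (1 < k)%N -> f 0%MM = 0 -> g 0%MM = 0 ->
  mps_ordge N (f - g) -> mps_ordge N.+1 (f ^+ k - g ^+ k).
Proof.
case: k => [|[|k]] // _ f0 g0 H; rewrite subrXX -[N.+1]addn1.
apply: ordgeM => //; apply: ordge_sum => i _; apply/ordge_coef0.
rewrite mps_coefM0 !mps_coefX0 f0 g0.
case: (nat_of_ord i) (ltn_ord i) => [|j] _; last by rewrite !expr0n mulr0.
by rewrite !expr0n mul0r.
Qed.

Definition mps_of_mpoly (p : {mpoly R[n]}) : mps n R := MPS (fun m => p@_m).

Lemma mps_truncK N f : mps_ordge N (f - mps_of_mpoly (mps_trunc N f)).
Proof. by apply: eq_ordge => m mN /=; rewrite mcoeff_trunc. Qed.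
End SeriesOrder.

Section Substitution.
Context (n k : nat) (R : comNzRingType) (g : n.-tuple (mps k R)).
Hypothesis g0 : forall j, tnth g j 0%MM = 0.
Implicit Types (f : mps n R) (p : {mpoly R[n]}).

Definition mps_eval p : mps k R := mmap (@mpsC k R) (tnth g) p.

HB.instance Definition _ := GRing.RMorphism.copy mps_eval (mmap (@mpsC k R) (tnth g)).

Lemma ordge_mmap1 (i : 'X_{1..n}) : mps_ordge (mdeg i) (mmap1 (tnth g) i).
Proof.
rewrite mdegE /mmap1; elim/big_rec2: _ => [m|j x y _ H] //.
apply: ordgeM => //; rewrite -[X in mps_ordge X]mul1n; apply: ordgeX.
exact/ordge_coef0.
Qed.

Lemma ordge_eval N p : (forall i, (mdeg i < N)%N -> p@_i = 0) ->
  mps_ordge N (mps_eval p).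
Proof.
move=> H; apply: ordge_sum => i _; case: (ltnP (mdeg i) N) => iN.
  by rewrite H // rmorph0 mul0r; apply: ordge0.
by apply: ordgeMl; apply: ordgeW iN _; apply: ordge_mmap1.
Qed.

Lemma subst_coef f p m : (forall i, (mdeg i <= mdeg m)%N -> p@_i = f i) ->
  mps_subst f g m = mps_eval p m.
Proof.
move=> H; set N := (mdeg m).+1.
have -> : mps_subst f g m = mps_eval (mps_trunc N f) m.
  rewrite (raddf_sum mps_eval) mps_coef_sum; apply: eq_bigr => i _.
  by rewrite /= /mps_eval mmapZ mmapX mpsC_mulE.
apply: (@ordge_eq _ _ N) => //; rewrite -raddfB; apply: ordge_eval => i iN.
by rewrite mcoeffB mcoeff_trunc // H ?subrr.
Qed.

Lemma subst_trunc N f : mps_ordge N (mps_subst f g - mps_eval (mps_trunc N f)).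
Proof.
apply: eq_ordge => m mN; apply: subst_coef => i im.
by rewrite mcoeff_trunc // (leq_ltn_trans im).
Qed.

Lemma subst_ordge N f : mps_ordge N f -> mps_ordge N (mps_subst f g).
Proof.
move=> H m mN; rewrite (@subst_coef f 0) ?rmorph0 ?mps_coef0 // => i im.
by rewrite mcoeff0 H // (leq_ltn_trans im).
Qed.

Fact subst_is_zmod_morphism : zmod_morphism (fun f => mps_subst f g).
Proof.
move=> f f'; apply: mpsP => m /=; rewrite -sumrB; apply: eq_bigr => i _.
by rewrite mulrBl.
Qed.

Lemma substC (r : R) : mps_subst (mpsC n r) g = mpsC k r.
Proof.
apply: mpsP => m; rewrite (@subst_coef _ r%:MP) ?/mps_eval ?mmapC // => i _.
by rewrite mcoeffC /=; case: eqP; rewrite (mulr1, mulr0).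
Qed.

Fact subst_is_monoid_morphism : monoid_morphism (fun f => mps_subst f g).
Proof.
split=> [|f f']; first exact: substC.
apply: ordge_ext => N.
apply: (@ordge_trans _ _ _ _ (mps_eval (mps_trunc N f * mps_trunc N f'))).
  apply: eq_ordge => m mN; apply: subst_coef => i im.
  apply: esym; apply: mps_coefM => j ji; apply: mcoeff_trunc;
  exact: leq_ltn_trans (leq_trans ji im) mN.
by rewrite rmorphM; apply/ordgeBC/ordge_mulB; apply: subst_trunc.
Qed.

(* An alias carrying the hypothesis on [g], so that the ring morphism structure,
   which depends on it, can be inferred. *)
Definition substm of (forall j, tnth g j 0%MM = 0) := fun f => mps_subst f g.

HB.instance Definition _ := GRing.isZmodMorphism.Build (mps n R) (mps k R)
  (substm g0) subst_is_zmod_morphism.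
HB.instance Definition _ := GRing.isMonoidMorphism.Build (mps n R) (mps k R)
  (substm g0) subst_is_monoid_morphism.

Lemma substmE f : substm g0 f = mps_subst f g. Proof. by []. Qed.

Lemma substX i : mps_subst (mpsX R i) g = tnth g i.
Proof.
apply: mpsP => m; rewrite (@subst_coef _ 'X_i) ?/mps_eval ?mmapX ?mmap1U // => j _.
by rewrite mcoeffX eq_sym.
Qed.
End Substitution.

Lemma subst_coef0 n k (R : comNzRingType) (f : mps n R) (g : n.-tuple (mps k R)) :
  (mps_subst f g) 0%MM = f 0%MM.
Proof.
rewrite /=; set N := (mdeg _).+1.
have d0 : (mdeg (0%MM : 'X_{1..n}) < N)%N by rewrite mdeg0.
rewrite (bigD1 (BMultinom d0)) //= [X in _ + X]big1 => [|i].
  have -> : \prod_(j < n) tnth g j ^+ (0%MM : 'X_{1..n}) j = 1.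
    by apply: big1 => j _; rewrite mnmE expr0.
  by rewrite mps_coef1 eqxx mulr1 addr0.
have : (mdeg i <= mdeg (0%MM : 'X_{1..k}))%N := bmdeg i.
rewrite [X in (_ <= X)%N]mdeg0 leqn0 mdeg_eq0 => /eqP iN.
by case/eqP; apply: val_inj.
Qed.

Lemma subst_comp n k l (R : comNzRingType) (f : mps n R)
    (g : n.-tuple (mps k R)) (h : k.-tuple (mps l R)) :
    (forall j, tnth g j 0%MM = 0) -> (forall j, tnth h j 0%MM = 0) ->
  mps_subst (mps_subst f g) h = mps_subst f [tuple mps_subst (tnth g j) h | j < n].
Proof.
move=> g0 h0; have gh0 j : tnth [tuple mps_subst (tnth g j) h | j < n] j 0%MM = 0.
  by rewrite tnth_mktuple subst_coef0.
apply: ordge_ext => N.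
apply: (@ordge_trans _ _ _ _ (mps_subst (mps_eval g (mps_trunc N f)) h)).
  rewrite -!(substmE h0) -raddfB; apply: subst_ordge => //; exact: subst_trunc.
apply: ordgeBC; have -> : mps_subst (mps_eval g (mps_trunc N f)) h =
    mps_eval [tuple mps_subst (tnth g j) h | j < n] (mps_trunc N f).
  rewrite -(substmE h0) /mps_eval /mmap raddf_sum /=; apply: eq_bigr => i _.
  rewrite rmorphM /= substmE substC // /mmap1 rmorph_prod; congr (_ * _).
  by apply: eq_bigr => j _; rewrite rmorphXn tnth_mktuple.
exact: subst_trunc.
Qed.

Lemma subst_id n (R : comNzRingType) (f : mps n R) :
  mps_subst f [tuple mpsX R j | j < n] = f.
Proof.
have g0 j : tnth [tuple mpsX R j | j < n] j 0%MM = 0.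
  by rewrite tnth_mktuple /= eq_sym mnm1_eq0.
apply: ordge_ext => N; apply: (ordge_trans (subst_trunc g0 f)).
suff E p : mps_eval [tuple mpsX R j | j < n] p = mps_of_mpoly p.
  by rewrite E; apply: ordgeBC; apply: mps_truncK.
have XE j : mpsX R j = mps_of_mpoly 'X_j :> mps n R.
  by apply: mpsP => m; rewrite /= mcoeffX eq_sym.
have ME (p1 p2 : {mpoly R[n]}) :
    mps_of_mpoly (p1 * p2) = mps_of_mpoly p1 * mps_of_mpoly p2 :> mps n R.
  by apply: mpsP => m; apply: esym; apply: mps_coefM.
elim/mpolyind: p => [|c m p _ _ IH]; first by
  rewrite rmorph0; apply: mpsP => m; rewrite mps_coef0 /= mcoeff0.
rewrite raddfD /= IH; have -> : mps_eval [tuple mpsX R j | j < n] (c *: 'X_[m])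
    = mps_of_mpoly (c *: 'X_[m]).
  rewrite /mps_eval mmapZ mmapX; apply: mpsP => m'; rewrite mpsC_mulE /= mcoeffZ.
  congr (_ * _); move: m'; suff -> : mmap1 (tnth [tuple mpsX R j | j < n]) m
     = mps_of_mpoly 'X_[m] by [].
  rewrite [in RHS]mpolyXE_id /mmap1.
  have M1 : mps_of_mpoly 1 = 1 :> mps n R.
    by apply: mpsP => m'; rewrite mps_coef1 /= mcoeff1.
  rewrite (big_morph (@mps_of_mpoly n R) ME M1); apply: eq_bigr => i _.
  rewrite tnth_mktuple XE; elim: (m i) => [|s IHs]; first by rewrite !expr0 M1.
  by rewrite !exprS ME IHs.
by apply: mpsP => m' /=; rewrite mcoeffD.
Qed.

Section SeriesMap.
Context (n : nat) (R S : comNzRingType) (u : {rmorphism R -> S}).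

Fact mps_map_is_zmod_morphism : zmod_morphism (@mps_map n R S u).
Proof. by move=> f g; apply: mpsP => m /=; rewrite rmorphB. Qed.

Fact mps_map_is_monoid_morphism : monoid_morphism (@mps_map n R S u).
Proof.
split=> [|f g]; first by apply: mpsP => m /=; case: eqP; rewrite ?rmorph1 ?rmorph0.
apply: mpsP => m /=; rewrite rmorph_sum; apply: eq_bigr => k _.
by rewrite rmorphM.
Qed.

HB.instance Definition _ := GRing.isZmodMorphism.Build (mps n R) (mps n S)
  (@mps_map n R S u) mps_map_is_zmod_morphism.
HB.instance Definition _ := GRing.isMonoidMorphism.Build (mps n R) (mps n S)
  (@mps_map n R S u) mps_map_is_monoid_morphism.

Lemma mps_mapX i : mps_map u (mpsX R i) = mpsX S i :> mps n S.
Proof. by apply: mpsP => m /=; rewrite rmorph_nat. Qed.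
End SeriesMap.

Lemma mps_map_subst n k (R S : comNzRingType) (u : {rmorphism R -> S})
    (f : mps n R) (g : n.-tuple (mps k R)) :
  mps_map u (mps_subst f g) =
  mps_subst (mps_map u f) [tuple mps_map u (tnth g j) | j < n].
Proof.
apply: mpsP => m /=; rewrite rmorph_sum; apply: eq_bigr => i _.
rewrite rmorphM; congr (_ * _).
under [in RHS]eq_bigr => j _ do rewrite tnth_mktuple -(rmorphXn (mps_map u)).
by rewrite -(rmorph_prod (mps_map u)).
Qed.

Lemma mps_map_inj n (R S : comNzRingType) (u : R -> S) :
  injective u -> injective (@mps_map n R S u).
Proof.
by move=> ui f g H; apply: mpsP => m; apply/ui/(congr1 (fun h => mps_coef h m) H).
Qed.

(** * Laurent series in one variable *)

Lemma fracP (R : idomainType) (x : {fraction R}) :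
  exists a b, b != 0 /\ x = tofrac a / tofrac b.
Proof.
elim/quotW: x => r; exists (\n_r), (\d_r); split; first exact: denom_ratioP.
apply: (canRL (mulfK _)); first by rewrite tofrac_eq0 denom_ratioP.
apply: (etrans (y := FracField.mul (\pi_{fraction R} r)%qT (tofrac \d_r))) => //.
rewrite ![tofrac _]/(FracField.tofrac _) /FracField.tofrac -!lock /=.
rewrite -FracField.pi_mul; apply/eqP; rewrite FracField.equivf_def.
by rewrite /FracField.mulf !numden_Ratio ?mulf_neq0 ?oner_neq0 ?denom_ratioP // !mulr1 mulrC.
Qed.

Section UnivariateSeries.
Context (K : fieldType).
Implicit Types (f g : mps 1 K).
Local Notation z := (mpsX K (ord0 : 'I_1)).

Lemma mpsX_coef0 : z 0%MM = 0.
Proof. by rewrite /= eq_sym mnm1_eq0. Qed.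

Lemma mulzE f m : (z * f) (U_(ord0) + m)%MM = f m.
Proof.
rewrite (@mps_coefM _ _ z f _ 'X_[U_(ord0)] (mps_trunc (mdeg (U_(ord0) + m)%MM).+1 f)).
- rewrite mulrC mcoeffMX mcoeff_trunc // mdegD mdeg1; exact: leqnSn.
- by move=> k _; rewrite mcoeffX eq_sym.
- by move=> k km; rewrite mcoeff_trunc.
Qed.

Lemma mnm_0_or_U (m : 'X_{1..1}) : m = 0%MM \/ exists m', m = (U_(ord0) + m')%MM.
Proof.
case E : (m ord0) => [|s].
  by left; apply/mnmP => i; rewrite (_ : i = ord0) ?ord1 // E mnm0E.
right; exists (m - U_(ord0))%MM; rewrite addmC submK //.
by apply/mnm_lepP => i; rewrite (_ : i = ord0) ?ord1 // E mnm1E eqxx.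
Qed.

Lemma dvd_z f : f 0%MM = 0 -> exists g, f = z * g.
Proof.
move=> f0; exists (MPS (fun m => f (U_(ord0) + m)%MM)); apply: mpsP => m.
case: (mnm_0_or_U m) => [->|[m' ->]]; last by rewrite mulzE.
by rewrite mps_coefM0 mpsX_coef0 mul0r.
Qed.

Lemma mps_unit f : f 0%MM != 0 -> exists g, f * g = 1.
Proof.
move=> f0; pose E : mps 1 K := MPS (fun=> 1); have zE : (1 - z) * E = 1.
  rewrite mulrBl mul1r; apply/eqP; rewrite subr_eq addrC -subr_eq; apply/eqP.
  apply: mpsP => m; case: (mnm_0_or_U m) => [->|[m' ->]].
    by rewrite mps_coefM0 mpsX_coef0 mul0r /= eqxx subrr.
  by rewrite mulzE /= mnmD_eq0 mnm1_eq0 /= subr0.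
pose h := 1 - mpsC 1 (f 0%MM)^-1 * f.
have h0 j : tnth [tuple h] j 0%MM = 0.
  have -> : tnth [tuple h] j = h by rewrite (ord1 j).
  by rewrite mps_coefB mpsC_mulE mps_coef1 eqxx mulVf ?subrr.
exists (mpsC 1 (f 0%MM)^-1 * mps_subst E [tuple h]).
have := congr1 (substm h0) zE; rewrite rmorph1 rmorphM rmorphB rmorph1 /= !substmE.
by rewrite substX // /h opprB addrC subrK mulrA (mulrC f).
Qed.

Lemma mps_unit_inv f : f 0%MM != 0 -> exists2 g : mps 1 K, g 0%MM != 0 & f * g = 1.
Proof.
move=> f0; have [g fg] := mps_unit f0; exists g => //.
move/(congr1 (fun h : mps 1 K => h 0%MM)): fg; rewrite mps_coefM0 mps_coef1 eqxx.
by apply: contra_eq_neq => ->; rewrite mulr0 eq_sym oner_neq0.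
Qed.

Lemma mps_factor f : f != 0 -> exists n (g : mps 1 K), g 0%MM != 0 /\ f = z ^+ n * g.
Proof.
move=> fn0; have [m fm] : exists m, f m != 0.
  apply: contrapT => H; case/eqP: fn0; apply: mpsP => m; rewrite mps_coef0.
  by apply: contrapT => /eqP fm; apply: H; exists m.
elim: {m}(mdeg m) {-2}m (erefl (mdeg m)) f fm {fn0} => [|s IH] m ms f fm.
  by exists 0%N, f; rewrite expr0 mul1r; move/eqP: ms fm; rewrite mdeg_eq0 => /eqP ->.
case: (eqVneq (f 0%MM) 0) => [/dvd_z [g fE]|f0]; last by exists 0%N, f; rewrite expr0 mul1r.
case: (mnm_0_or_U m) ms fm => [->|[m' ->]]; first by rewrite mdeg0.
rewrite mdegD mdeg1 fE mulzE => -[m's] gm.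
by have [n [h [h0 ->]]] := IH _ m's _ gm; exists n.+1, h; rewrite exprS mulrA.
Qed.

Lemma mpsX_neq0 : z != 0.
Proof.
apply/eqP => /(congr1 (fun f : mps 1 K => f U_(ord0)%MM)).
by rewrite mps_coef0 /= eqxx; apply/eqP; rewrite oner_neq0.
Qed.

Local Notation T := (laurentT K).

Lemma laurentT_neq0 : T != 0.
Proof. by rewrite invr_eq0 tofrac_eq0 mpsX_neq0. Qed.

Lemma laurentTV : T^-1 = tofrac z.
Proof. by rewrite invrK. Qed.

Lemma tofrac_inj (R : idomainType) : injective (@tofrac R).
Proof. by move=> x y /eqP; rewrite tofrac_eq => /eqP. Qed.

Lemma laurent_factor (s : laurent K) : s != 0 ->
  (exists n (g : mps 1 K), g 0%MM != 0 /\ s = tofrac (z ^+ n * g)) \/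
  (exists n (g : mps 1 K), g 0%MM != 0 /\ s = T ^+ n.+1 * tofrac g).
Proof.
have [a [b [b0 ->]]] := fracP s => s0.
have /mps_factor [n [g [g0 aE]]] : a != 0.
  by apply: contraNneq s0 => ->; rewrite rmorph0 mul0r.
have [m [h [h0 bE]]] := mps_factor b0; have [k k0 hk] := mps_unit_inv h0.
have gk0 : (g * k) 0%MM != 0 by rewrite mps_coefM0 mulf_neq0.
have E : tofrac a / tofrac b = tofrac z ^+ n * T ^+ m * tofrac (g * k).
  apply: (canLR (mulfK _)); first by rewrite tofrac_eq0.
  rewrite aE bE !rmorphM !rmorphXn /=.
  have -> : forall t : laurent K, t * (tofrac z ^+ m * tofrac h) = t * tofrac z ^+ m * tofrac h by move=> t; rewrite mulrA.
  have -> : tofrac z ^+ n * T ^+ m * (tofrac g * tofrac k) * tofrac z ^+ m * tofrac h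
     = tofrac z ^+ n * (T * tofrac z) ^+ m * (tofrac g * (tofrac h * tofrac k)).
    by rewrite exprMn; ring.
  rewrite mulVf ?tofrac_eq0 ?mpsX_neq0 // expr1n mulr1 -(rmorphM (@tofrac _) h) hk.
  by rewrite rmorph1 mulr1.
rewrite E; case: (leqP m n) => mn; [left|right].
  exists (n - m)%N, (g * k); split=> //.
  rewrite -{1}(subnK mn) exprD -[_ * T ^+ m]mulrA -exprMn divff ?tofrac_eq0 ?mpsX_neq0 //.
  by rewrite expr1n mulr1 [in RHS]rmorphM rmorphXn.
exists (m - n.+1)%N, (g * k); split=> //; rewrite -subSn // subSS.
rewrite -{1}(subnK (ltnW mn)) exprD mulrCA -exprMn divff ?tofrac_eq0 ?mpsX_neq0 //.
by rewrite expr1n mulr1.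
Qed.
End UnivariateSeries.

(** * Binomial coefficients modulo powers of p *)

Section PrimeToPFactorial.
Context (p : nat) (p_pr : prime p).

(* Up to sign, Morita's p-adic Gamma function at [m + 1]. *)
Definition fact_coprime (m : nat) : nat :=
  (\prod_(1 <= j < m.+1) if p %| j then 1 else j)%N.

Lemma fact_coprimeS m :
  fact_coprime m.+1 = (fact_coprime m * if p %| m.+1 then 1 else m.+1)%N.
Proof. by rewrite /fact_coprime big_nat_recr. Qed.

Lemma coprime_fact_coprime m : coprime p (fact_coprime m).
Proof.
elim: m => [|m IH]; first by rewrite /fact_coprime big_geq // coprimen1.
rewrite fact_coprimeS coprimeMr IH /=; case: ifP => [|/negbT]; first by rewrite coprimen1.
by rewrite prime_coprime.
Qed.

Lemma fact_coprime_split m :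
  (m`! = fact_coprime m * (p ^ (m %/ p) * (m %/ p)`!))%N.
Proof.
elim: m => [|m IH]; first by rewrite /fact_coprime big_geq // div0n.
rewrite factS IH fact_coprimeS divnS ?prime_gt0 //; case: ifP => pm; last first.
  by rewrite add0n mulnA [(m.+1 * _)%N]mulnC.
have E : m.+1 = ((m %/ p).+1 * p)%N.
  by rewrite -{1}(divnK pm) divnS ?prime_gt0 // pm.
by rewrite add1n muln1 factS expnS {1}E; ring.
Qed.

Lemma fact_coprimeD r m : fact_coprime (p ^ r.+1 + m) =
  fact_coprime (p ^ r.+1) * fact_coprime m %[mod p ^ r.+1].
Proof.
elim: m => [|m IH].
  by rewrite addn0 [fact_coprime 0]big_geq ?muln1.
rewrite addnS !fact_coprimeS -addnS dvdn_addr ?dvdn_exp // mulnA -modnMm IH modnMm.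
by case: ifP => [//|_]; rewrite -[LHS]modnMmr modnDl modnMmr.
Qed.

Lemma fact_coprimeDM r m t : fact_coprime (p ^ r.+1 * t + m) =
  fact_coprime (p ^ r.+1) ^ t * fact_coprime m %[mod p ^ r.+1].
Proof.
elim: t => [|t IH]; first by rewrite muln0 add0n expn0 mul1n.
by rewrite mulnS -addnA fact_coprimeD -[LHS]modnMmr IH modnMmr (expnS (fact_coprime _)) mulnA.
Qed.
End PrimeToPFactorial.

Section PadicIntegers.
Context (p : nat) (p_pr : prime p).
Local Notation Zp := (padic_int p_pr).

Lemma padic_res_nat (k n : nat) : (k%:R : Zp) n = k%:R.
Proof. by elim: k => [|k IH] //; rewrite !mulrS -IH. Qed.

Lemma padic_res0 n : (0 : Zp) n = 0. Proof. by []. Qed.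

Lemma eq_natr_Zp q (a b : nat) : (1 < q)%N ->
  (a%:R == b%:R :> 'Z_q) = (a == b %[mod q]).
Proof. by move=> q1; rewrite -val_eqE /= !val_Zp_nat. Qed.

Lemma padic_nat_neq0 (k : nat) : (k.+1%:R : Zp) != 0.
Proof.
apply/eqP => /(congr1 (fun x : Zp => x k.+1)); rewrite padic_res_nat padic_res0.
move/eqP; rewrite -[0]/(0%:R) eq_natr_Zp ?pexp_gt1 // mod0n modn_small //.
by apply: ltn_trans (ltn_expl k.+1 (prime_gt1 p_pr)) _; rewrite ltn_exp2l ?prime_gt1.
Qed.

Lemma padic_dvd (x : Zp) k : x k = 0 -> exists y : Zp, x = p%:R ^+ k.+1 * y.
Proof.
move=> xk.
have dv n : (p ^ k.+1 %| x (n + k.+1)%N)%N.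
  by rewrite addnS -addSn addnC /dvdn padic_res_mod xk mod0n.
pose y n : nat := (x (n + k.+1)%N %/ p ^ k.+1)%N.
have yE n : (y n * p ^ k.+1 = x (n + k.+1)%N)%N by rewrite divnK.
have yc : padic_compat (fun n => (y n)%:R : 'Z_(p ^ n.+1)).
  move=> n; rewrite !val_Zp_nat ?pexp_gt1 // padic_modS modn_mod.
  have pk0 : (0 < p ^ k.+1)%N by rewrite expn_gt0 prime_gt0.
  apply/eqP; rewrite -(eqn_pmul2r pk0).
  rewrite !muln_modl // -expnD !yE.
  by apply/eqP; apply: (padic_resP x (n + k.+1)%N).
exists (Padic p_pr yc); apply: padicP => n.
rewrite -natrX -[RHS]/(((p ^ k.+1)%:R : Zp) n * (y n)%:R) padic_res_nat -natrM mulnC yE.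
by apply: val_inj; rewrite /= val_Zp_nat ?pexp_gt1 // padic_res_mod modn_small ?ltn_Zp.
Qed.

Lemma padic_fermat (x : Zp) : exists y : Zp, x ^+ p - x = p%:R * y.
Proof.
have [|y] := @padic_dvd (x ^+ p - x) 0; last by rewrite expr1; exists y.
have resX n : (x ^+ n) 0%N = x 0%N ^+ n by elim: n => [|n IH] //; rewrite !exprS -IH.
rewrite -[LHS]/((x ^+ p) 0%N - x 0%N) resX -(natr_Zp (x 0%N)) -natrX.
apply/eqP; rewrite subr_eq0 eq_natr_Zp ?pexp_gt1 //.
by move: (nat_of_ord _) => a; rewrite expn1; apply/eqP/fermat_little.
Qed.

(* [u] is the p-adic limit of the ratios [N k / D k]. *)
Lemma padic_ratio (c N D : nat -> nat) :
    (forall k, coprime p (D k)) ->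
    (forall k, (N k.+1 * D k = N k * D k.+1 %[mod p ^ k.+1])%N) ->
    (forall k, (c k.+1 * D k = c k * N k)%N) ->
  exists u : Zp, forall k, exists y : Zp,
    (c k.+1)%:R - u * (c k)%:R = p%:R ^+ k.+1 * y.
Proof.
move=> cD ND cE; pose u k : 'Z_(p ^ k.+1) := (N k)%:R / (D k)%:R.
have Du j k : (D j)%:R \is a @GRing.unit 'Z_(p ^ k.+1).
  by rewrite unitZpE ?pexp_gt1 // coprimeXl.
have uD k : u k * (D k)%:R = (N k)%:R by rewrite /u divrK ?Du.
have uc : padic_compat u.
  move=> k; set v : nat := u k.+1.
  suff vE : v%:R = u k.
    by rewrite -vE val_Zp_nat ?pexp_gt1 // modn_mod.
  apply: (mulIr (Du k k)); rewrite uD; apply: (mulIr (Du k.+1 k)).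
  rewrite -mulrA [_%:R * _%:R]mulrC mulrA -!natrM.
  apply/eqP; rewrite eq_natr_Zp ?pexp_gt1 // -ND -modnMml.
  have : v * D k.+1 = N k.+1 %[mod p ^ k.+2].
    by apply/eqP; rewrite -eq_natr_Zp ?pexp_gt1 // natrM natr_Zp uD.
  move/(congr1 (modn^~ (p ^ k.+1)%N)); rewrite !padic_modS => ->.
  by rewrite modnMml.
exists (Padic p_pr uc) => k; apply: padic_dvd.
rewrite -[LHS]/(((c k.+1)%:R : Zp) k - u k * ((c k)%:R : Zp) k) !padic_res_nat.
apply: (mulIr (Du k k)); rewrite mul0r mulrBl mulrAC uD -!natrM cE mulnC.
exact: subrr.
Qed.

Lemma binomial_padic_ratio (d b : nat) : (0 < d)%N -> (0 < b < d)%N -> p = 1 %[mod d] ->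
  exists u : Zp, forall k, exists y : Zp,
    let c k := ('C((p ^ k - 1) %/ d * b, (p ^ k - 1) %/ d))%N%:R in
    c k.+1 - u * c k = p%:R ^+ k.+1 * y.
Proof.
move=> d0 /andP [b0 bd] pd; pose n k := ((p ^ k - 1) %/ d)%N.
have p0 := prime_gt0 p_pr; have pk0 k : (0 < p ^ k)%N by rewrite expn_gt0 p0.
have nd k : (n k * d = p ^ k - 1)%N.
  by rewrite divnK // -eqn_mod_dvd // -modnXm pd modnXm exp1n.
have nS j k : (n (j + k) = p ^ j * n k + n j)%N.
  apply/eqP; rewrite -(eqn_pmul2r d0) mulnDl -mulnA !nd expnD mulnBr muln1.
  by rewrite addnBA // subnK // -{1}[(p ^ j)%N]muln1 leq_mul2l pk0 orbT.
pose P := fact_coprime p; pose b' := b.-1; have bE : b = b'.+1 by rewrite prednK.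
have small x : (x <= b)%N -> (x * n 1 < p)%N.
  move=> xb; have := nd 1%N; rewrite expn1 => E.
  by apply: leq_ltn_trans (_ : p - 1 < p)%N; [rewrite -E mulnC leq_mul2l (leq_trans xb (ltnW bd)) orbT|lia].
have nf x k : (x <= b)%N -> (x * n k.+1 %/ p = x * n k)%N.
  move=> xb; rewrite -add1n nS expn1 mulnDr mulnCA [(p * _)%N]mulnC divnMDl //.
  by rewrite divn_small ?addn0 ?small.
pose c k := 'C(n k * b, n k).
have cE k : (c k * ((n k)`! * (b' * n k)`!) = (b * n k)`!)%N.
  have -> : (b' * n k = b * n k - n k)%N by rewrite bE mulSn addKn.
  by rewrite /c [(n k * b)%N]mulnC bin_fact ?leq_pmull.
have := @padic_ratio c (fun k => P (b * n k.+1)%N)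
  (fun k => P (n k.+1) * P (b' * n k.+1))%N.
case=> [k|k|k|u Hu].
- by rewrite coprimeMr !coprime_fact_coprime.
- have X x : P (x * n k.+2)%N = P (p ^ k.+1)%N ^ (x * n 1) * P (x * n k.+1)%N %[mod p ^ k.+1].
    by rewrite -fact_coprimeDM // -[in LHS]addn1 nS mulnDr mulnCA.
  have := X 1%N; rewrite !mul1n => X1.
  have MM A A' B B' : A = A' %[mod p ^ k.+1] -> B = B' %[mod p ^ k.+1] ->
      A * B = A' * B' %[mod p ^ k.+1].
    by move=> E1 E2; rewrite -[LHS]modnMm E1 E2 modnMm.
  rewrite (MM _ _ _ _ (X b) (erefl _)).
  rewrite [RHS](MM _ _ _ _ (erefl _) (MM _ _ _ _ X1 (X b'))).
  by congr (_ %% _)%N; rewrite {1}bE mulSn expnD; ring.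
- have E := cE k.+1; have E' := cE k.
  rewrite !(fact_coprime_split p_pr (_ * n k.+1)) (fact_coprime_split p_pr (n k.+1)) in E.
  have n1 := nf 1%N k b0; rewrite !mul1n in n1.
  rewrite !nf ?n1 // -?E' in E; last by rewrite bE.
  have z : (0 < p ^ (b * n k) * ((n k)`! * (b' * n k)`!))%N.
    by rewrite !muln_gt0 !fact_gt0 expn_gt0 p0.
  apply/eqP; rewrite -(eqn_pmul2r z); apply/eqP; rewrite -/(P _) in E.
  rewrite [in RHS]mulnAC.
  transitivity (P (b * n k.+1) * (p ^ (b * n k) * (c k * ((n k)`! * (b' * n k)`!))))%N; last by ring.
  by rewrite -E {1}bE mulSn expnD /P; ring.
by exists u.
Qed.
End PadicIntegers.

(** * The functional equation lemma *)

Section NatDivisibility.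
Context (S : comNzRingType).
Implicit Types (q : nat) (x y : S).

Definition nat_dvd q x := exists y, x = q%:R * y.

Lemma nat_dvdD q x y : nat_dvd q x -> nat_dvd q y -> nat_dvd q (x + y).
Proof. by move=> [a ->] [b ->]; exists (a + b); rewrite mulrDr. Qed.

Lemma nat_dvdMr q x y : nat_dvd q x -> nat_dvd q (x * y).
Proof. by move=> [a ->]; exists (a * y); rewrite mulrA. Qed.

Lemma nat_dvdMl q x y : nat_dvd q y -> nat_dvd q (x * y).
Proof. by rewrite mulrC; apply: nat_dvdMr. Qed.

Lemma nat_dvdM q r x y : nat_dvd q x -> nat_dvd r y -> nat_dvd (q * r) (x * y).
Proof. by move=> [a ->] [b ->]; exists (a * b); rewrite natrM mulrACA. Qed.

Lemma nat_dvd_trans q x y t : nat_dvd q (x - y) -> nat_dvd q (y - t) -> nat_dvd q (x - t).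
Proof. by move=> H1 H2; move: (nat_dvdD H1 H2); rewrite addrA subrK. Qed.

Lemma nat_dvd_sum q I (r : seq I) (P : pred I) (F : I -> S) :
  (forall i, P i -> nat_dvd q (F i)) -> nat_dvd q (\sum_(i <- r | P i) F i).
Proof.
move=> H; elim/big_rec: _ => [|i x Pi]; first by exists 0; rewrite mulr0.
by apply: nat_dvdD; apply: H.
Qed.

Lemma nat_dvdXX q x y k : nat_dvd q (x - y) -> nat_dvd q (x ^+ k - y ^+ k).
Proof. by rewrite subrXX; apply: nat_dvdMr. Qed.

Context (p : nat) (p_pr : prime p).

Lemma nat_dvd_expDp x y : nat_dvd p ((x + y) ^+ p - (x ^+ p + y ^+ p)).
Proof.
case: p p_pr => [|q] q_pr //; rewrite exprDn big_ord_recl big_ord_recr /=.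
rewrite subn0 subnn !expr0 bin0 binn !mulr1n mulr1 mul1r.
rewrite (_ : bump 0 q = q.+1); last by rewrite /bump leq0n add1n.
have -> (a t b : S) : a + (t + b) - (a + b) = t by ring.
apply: nat_dvd_sum => i _; rewrite -mulr_natr; apply: nat_dvdMl.
have /dvdnP [s ->] : (q.+1 %| 'C(q.+1, bump 0 i))%N.
  by apply: prime_dvd_bin => //; rewrite /bump /= add1n ltnS ltn_ord.
by exists s%:R; rewrite mulnC natrM.
Qed.

Lemma nat_dvd_sum_expp I (r : seq I) (F : I -> S) :
  nat_dvd p ((\sum_(i <- r) F i) ^+ p - \sum_(i <- r) F i ^+ p).
Proof.
elim: r => [|i r IH].
  by exists 0; rewrite !big_nil expr0n gtn_eqF ?prime_gt0 // subr0 mulr0.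
rewrite !big_cons; apply: nat_dvd_trans (nat_dvd_expDp _ _) _.
by rewrite opprD addrACA subrr add0r.
Qed.

Lemma nat_dvd_expp k x y : nat_dvd (p ^ k.+1) (x - y) ->
  nat_dvd (p ^ k.+2) (x ^+ p - y ^+ p).
Proof.
move=> H; rewrite subrXX expnSr; apply: nat_dvdM => //.
have H1 : nat_dvd p (x - y).
  by case: H => a ->; exists ((p ^ k)%:R * a); rewrite expnS natrM mulrA.
have -> : \sum_(i < p) x ^+ (p.-1 - i) * y ^+ i =
    \sum_(i < p) (x ^+ (p.-1 - i) - y ^+ (p.-1 - i)) * y ^+ i + p%:R * y ^+ p.-1.
  rewrite mulr_natl -[X in _ *+ X]card_ord -sumr_const -big_split /=.
  apply: eq_bigr => i _; rewrite mulrBl -exprD subnK ?subrK //.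
  by rewrite -ltnS prednK ?prime_gt0.
apply: nat_dvdD; last by exists (y ^+ p.-1).
by apply: nat_dvd_sum => i _; apply: nat_dvdMr; apply: nat_dvdXX.
Qed.

Lemma nat_dvd_exppX k x y : nat_dvd p (x - y) ->
  nat_dvd (p ^ k.+1) (x ^+ (p ^ k) - y ^+ (p ^ k)).
Proof.
move=> H; elim: k => [|k IH]; first by rewrite expn0 !expr1 expn1.
by rewrite (expnSr p k) !exprM; apply: nat_dvd_expp.
Qed.
End NatDivisibility.

Lemma mpsX_exp (R : comNzRingType) j (m : 'X_{1..1}) :
  (mpsX R ord0 ^+ j) m = (m ord0 == j)%:R.
Proof.
have -> : (mpsX R ord0 ^+ j) m = ('X_[U_(ord0) *+ j] : {mpoly R[1]})@_m.
  elim: j m => [|j IH] m; first by rewrite expr0 mulm0n mps_coef1 mcoeffX eq_sym.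
  rewrite exprS mulmS mpolyXD; apply: mps_coefM => k _ //.
  by rewrite mcoeffX eq_sym.
rewrite mcoeffX; congr (_%:R); congr nat_of_bool; apply/eqP/eqP => [<-|E].
  by rewrite mulmnE mnm1E eqxx mul1n.
by apply/mnmP => i; rewrite (_ : i = ord0) ?ord1 // mulmnE mnm1E eqxx mul1n E.
Qed.

Lemma tuple1E T (F : 'I_1 -> T) : [tuple F j | j < 1] = [tuple F ord0].
Proof. by apply: eq_from_tnth => j; rewrite tnth_mktuple !(ord1 j). Qed.

Lemma tuple2E T (F : 'I_2 -> T) : [tuple F j | j < 2] = [tuple F 0; F 1].
Proof.
apply: eq_from_tnth => j; rewrite tnth_mktuple.
by case: j => [[|[|]]] // i; rewrite (tnth_nth (F 0)); congr F; apply: val_inj.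
Qed.

Lemma subst_ordgeM n k (R : comNzRingType) (f : mps n R) (g : n.-tuple (mps k R)) N M :
  (forall j, mps_ordge M (tnth g j)) -> mps_ordge N f -> mps_ordge (M * N) (mps_subst f g).
Proof.
move=> gM fN m mMN; apply: big1 => i _; case: (ltnP (mdeg i) N) => iN.
  by rewrite fN ?mul0r.
suff -> : (\prod_(j < n) tnth g j ^+ (i : 'X_{1..n}) j) m = 0 by rewrite mulr0.
suff H : mps_ordge (M * mdeg i) (\prod_(j < n) tnth g j ^+ (i : 'X_{1..n}) j).
  by apply: H; apply: leq_trans mMN _; rewrite leq_mul2l iN orbT.
rewrite mdegE big_distrr /=; elim/big_rec2: _ => [m'|j x y _ H] //.
by apply: ordgeM => //; apply: ordgeX.
Qed.

Section PowerSeriesSubstitution.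
Context (p : nat) (p_pr : prime p) (K : fieldType) (c : nat -> K).
Hypothesis c0 : c 0%N = 1.
Local Notation l := (p_power_series p c).
Local Notation term k := (c k / p%:R ^+ k).

Lemma log_coef0 : l 0%MM = 0.
Proof. by rewrite /= mnm0E big_mkcond big_ord1. Qed.

Lemma log_coef1 : l U_(ord0)%MM = 1.
Proof.
rewrite /= mnm1E eqxx big_mkcond 2!big_ord_recl big_ord0 -[nat_of_ord (lift _ _)]/1%N -[nat_of_ord ord0]/0%N.
by rewrite expn1 expn0 (gtn_eqF (prime_gt1 p_pr)) /= c0 divr1 !addr0.
Qed.

Context (n : nat).
Implicit Types f g : mps n K.

Lemma tnth1_coef0 f : f 0%MM = 0 -> forall j, tnth [tuple f] j 0%MM = 0.
Proof. by move=> f0 j; rewrite (ord1 j). Qed.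

Lemma log_subst N f : f 0%MM = 0 ->
  mps_ordge N (mps_subst l [tuple f] - \sum_(k < N) mpsC n (term k) * f ^+ (p ^ k)).
Proof.
move=> /tnth1_coef0 f0.
have E : mps_ordge N (l - \sum_(k < N) mpsC 1 (term k) * mpsX K ord0 ^+ (p ^ k)).
  apply: eq_ordge => m mN; rewrite mps_coef_sum.
  under [RHS]eq_bigr => k _ do rewrite mpsC_mulE mpsX_exp.
  have mE : mdeg m = m ord0 by rewrite mdegE big_ord1.
  rewrite mE in mN.
  rewrite /= (big_ord_widen_cond N (fun k => p ^ k == m ord0)%N (fun k => term k)) //.
  rewrite big_mkcond /=; apply: eq_bigr => k _; rewrite eq_sym.
  case: eqP => [->|]; last by rewrite mulr0.
  by rewrite mulr1 ltnS ltnW // ltn_expl ?prime_gt1.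
have := subst_ordge f0 E; rewrite -(substmE f0) rmorphB rmorph_sum /=.
under eq_bigr => k _ do rewrite rmorphM /= rmorphXn /= !substmE substC // substX //.
by [].
Qed.

Lemma log_subst0 : mps_subst l [tuple (0 : mps n K)] = 0.
Proof.
apply: ordge_ext => N; have := @log_subst N 0 (mps_coef0 _ _).
rewrite big1 // => k _.
by rewrite expr0n (gtn_eqF (_ : 0 < p ^ k)%N) ?expn_gt0 ?prime_gt0 // mulr0.
Qed.

Lemma log_subst_first N f g : f 0%MM = 0 -> g 0%MM = 0 -> mps_ordge N (f - g) ->
  mps_ordge N.+1 ((mps_subst l [tuple f] - mps_subst l [tuple g]) - (f - g)).
Proof.
move=> f0 g0 H.
have := ordgeB (@log_subst N.+1 f f0) (@log_subst N.+1 g g0).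
rewrite !big_ord_recl /= c0 expr0 divr1 expn0 !expr1 rmorph1 !mul1r.
set A := \sum_(i < N) _; set B := \sum_(i < N) _.
have AB : mps_ordge N.+1 (A - B).
  rewrite /A /B -sumrB; apply: ordge_sum => k _; rewrite -mulrBr; apply: ordgeMl.
  by apply: ordge_expB => //; rewrite -(expn0 p) ltn_exp2l ?prime_gt1.
move/ordgeD/(_ AB); congr mps_ordge; ring.
Qed.

Lemma log_subst_cong N f g : f 0%MM = 0 -> g 0%MM = 0 -> mps_ordge N (f - g) ->
  mps_ordge N (mps_subst l [tuple f] - mps_subst l [tuple g]).
Proof.
move=> f0 g0 H; have /(ordgeW (leqnSn N)) /ordgeD /(_ H) := log_subst_first f0 g0 H.
by rewrite subrK.
Qed.

Lemma log_subst_inj f g : f 0%MM = 0 -> g 0%MM = 0 ->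
  mps_subst l [tuple f] = mps_subst l [tuple g] -> f = g.
Proof.
move=> f0 g0 E; apply: ordge_ext; elim=> [|N IH] //.
by have := log_subst_first f0 g0 IH; rewrite E subrr sub0r => /ordgeN; rewrite opprK.
Qed.
End PowerSeriesSubstitution.

Definition mps_frob (p n : nat) (R : comNzRingType) (f : mps n R) : mps n R :=
  mps_subst f [tuple mpsX R j ^+ p | j < n].

Section Frobenius.
Context (p : nat) (p_pr : prime p) (n : nat).

Lemma frob_arg_coef0 (R : comNzRingType) j :
  tnth [tuple mpsX R j ^+ p | j < n] j 0%MM = 0.
Proof.
by rewrite tnth_mktuple mps_coefX0 /= eq_sym mnm1_eq0 expr0n gtn_eqF ?prime_gt0.
Qed.

Lemma frob_ordge (R : comNzRingType) N (f : mps n R) : (0 < N)%N ->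
  mps_ordge N f -> mps_ordge N.+1 (mps_frob p f).
Proof.
move=> N0 H; apply: (@ordgeW _ _ (p * N)); first by have := prime_gt1 p_pr; nia.
apply: subst_ordgeM => // j; rewrite tnth_mktuple -[p in mps_ordge p]mul1n.
by apply: ordgeX; apply/ordge_coef0; rewrite /= eq_sym mnm1_eq0.
Qed.

Lemma frob_map (R S : comNzRingType) (u : {rmorphism R -> S}) (f : mps n R) :
  mps_map u (mps_frob p f) = mps_frob p (mps_map u f).
Proof.
rewrite /mps_frob mps_map_subst; congr mps_subst; apply: eq_from_tnth => j.
by rewrite !tnth_mktuple rmorphXn /= mps_mapX.
Qed.

Lemma frob_log (K : fieldType) (l : mps 1 K) (f : mps n K) : f 0%MM = 0 ->
  mps_frob p (mps_subst l [tuple f]) = mps_subst l [tuple mps_frob p f].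
Proof.
move=> f0; rewrite /mps_frob subst_comp; first by rewrite tuple1E.
- exact: tnth1_coef0.
- exact: frob_arg_coef0.
Qed.

Lemma frob_congr (R : comNzRingType) (F : mps n R) :
  (forall x : R, nat_dvd p (x ^+ p - x)) -> nat_dvd p (F ^+ p - mps_frob p F).
Proof.
move=> fermat.
have id0 j : tnth [tuple mpsX R j | j < n] j 0%MM = 0.
  by rewrite tnth_mktuple /= eq_sym mnm1_eq0.
suff /choice [G GE] : forall m, exists y, (F ^+ p - mps_frob p F) m = p%:R * y.
  exists (MPS G); apply: mpsP => m; rewrite GE.
  by rewrite -[p%:R in RHS](rmorph_nat (@mpsC n R)) mpsC_mulE.
move=> m; set N := (mdeg m).+1; set P := mps_trunc N F.
have E1 : mps_ordge N (F ^+ p - mps_eval [tuple mpsX R j | j < n] P ^+ p).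
  by rewrite subrXX; apply: ordgeMr; rewrite -{1}(subst_id F); apply: subst_trunc.
have E2 : mps_ordge N (mps_frob p F - mps_eval [tuple mpsX R j ^+ p | j < n] P).
  by apply: subst_trunc; apply: frob_arg_coef0.
have [G GE] : nat_dvd p (mps_eval [tuple mpsX R j | j < n] P ^+ p -
                         mps_eval [tuple mpsX R j ^+ p | j < n] P).
  apply: nat_dvd_trans (nat_dvd_sum_expp p_pr _ _) _.
  rewrite /mps_eval /mmap -sumrB; apply: nat_dvd_sum => i _.
  have -> : mmap1 (tnth [tuple mpsX R j ^+ p | j < n]) i =
            mmap1 (tnth [tuple mpsX R j | j < n]) i ^+ p.
    rewrite /mmap1 -prodrXl; apply: eq_bigr => j _.
    by rewrite !tnth_mktuple -!exprM mulnC.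
  rewrite exprMn -mulrBl -rmorphXn -rmorphB /=; apply: nat_dvdMr.
  by have [y ->] := fermat P@_i; exists (mpsC n y); rewrite rmorphM rmorph_nat.
exists (G m); have mN : (mdeg m < N)%N by [].
rewrite mps_coefB (ordge_eq E1 mN) (ordge_eq E2 mN) -mps_coefB GE.
by rewrite -[p%:R in LHS](rmorph_nat (@mpsC n R)) mpsC_mulE.
Qed.
End Frobenius.

(* Hazewinkel's functional equation lemma, for the functional equation
   l(X) - (u / p) l(X^p) \in R[[X]]. *)
Section FunctionalEquation.
Context (p : nat) (p_pr : prime p) (R : idomainType).
Hypothesis p_neq0 : (p%:R : R) != 0.
Hypothesis fermat : forall x : R, nat_dvd p (x ^+ p - x).
Context (c : nat -> R) (u : R).
Hypothesis c0 : c 0%N = 1.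
Hypothesis cu : forall k, exists y, c k.+1 - u * c k = p%:R ^+ k.+1 * y.
Local Notation K := {fraction R}.
Local Notation "x %:F" := (tofrac x).
Local Notation l := (p_power_series p (fun k => (c k)%:F)).
Local Notation ell f := (mps_subst l [tuple f]).
Context (n : nat).
Implicit Types (f h : mps n K) (F : mps n R).

Let cF0 : (c 0%N)%:F = 1 :> K. Proof. by rewrite c0 rmorph1. Qed.

Let pF : (p%:R : K) != 0.
Proof. by rewrite -(rmorph_nat (@tofrac R)) tofrac_eq0. Qed.

Definition mps_integral f := exists F, f = mps_map (@tofrac R) F.

Lemma mps_integralP f : (forall m, exists a, f m = a%:F) -> mps_integral f.
Proof. by move=> /choice [a aE]; exists (MPS a); apply: mpsP. Qed.

Definition twist f := f - mpsC n (u%:F / p%:R) * mps_frob p f.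

Lemma twistB f h : twist (f - h) = twist f - twist h.
Proof.
rewrite /twist /mps_frob -!(substmE (@frob_arg_coef0 p p_pr n K)) rmorphB.
by rewrite mulrBr; ring.
Qed.

Lemma twistD f h : twist (f + h) = twist f + twist h.
Proof.
rewrite /twist /mps_frob -!(substmE (@frob_arg_coef0 p p_pr n K)) rmorphD.
by rewrite mulrDr; ring.
Qed.

Lemma map_coef0 F : F 0%MM = 0 -> mps_map (@tofrac R) F 0%MM = 0.
Proof. by rewrite /= => ->; rewrite rmorph0. Qed.

Lemma twist_log F : F 0%MM = 0 -> mps_integral (twist (ell (mps_map (@tofrac R) F))).
Proof.
move=> F0; set f := mps_map _ F; have f0 : f 0%MM = 0 by apply: map_coef0.
have [H HE] := frob_congr p_pr F fermat.
have /choice [y yE] := cu.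
have /choice [G GE] k : exists G : mps n R,
    mpsC n (c k.+1) * F ^+ (p ^ k.+1) - mpsC n (u * c k) * mps_frob p F ^+ (p ^ k) =
    (p ^ k.+1)%:R * G.
  have [D DE] := nat_dvd_exppX p_pr k (ex_intro _ H HE).
  exists (mpsC n (y k) * F ^+ (p ^ k.+1) + mpsC n (u * c k) * D).
  have -> : mpsC n (c k.+1) = mpsC n (u * c k) + (p ^ k.+1)%:R * mpsC n (y k).
    rewrite natrX -(rmorph_nat (@mpsC n R)) -rmorphXn -rmorphM -yE rmorphB.
    by rewrite addrC subrK.
  rewrite mulrDr [_ * (_ * D)]mulrCA -DE -exprM -expnS.
  by rewrite mulrDl mulrBr; ring.
apply: mps_integralP => m; set N := (mdeg m).+1.
have frf0 : mps_frob p f 0%MM = 0 by rewrite subst_coef0.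
have E1 := log_subst p_pr (fun k => (c k)%:F) (N := N.+1) f0.
have := ordgeMl (mpsC n (u%:F / p%:R)) (log_subst p_pr (fun k => (c k)%:F) (N := N) frf0).
rewrite mulrBr => E2; have mN : (mdeg m < N)%N by [].
rewrite /twist (frob_log p_pr _ f0) mps_coefB (ordge_eq E1 (ltnW mN)) (ordge_eq E2 mN).
rewrite -mps_coefB; exists ((F + \sum_(k < N) G k) m).
rewrite -[RHS]/(mps_map (@tofrac R) (F + \sum_(k < N) G k) m); congr (mps_coef _ m).
rewrite big_ord_recl rmorphD rmorph_sum -addrA; congr (_ + _).
  by rewrite expr0 divr1 expn0 expr1 cF0 rmorph1 mul1r.
rewrite mulr_sumr -sumrB; apply: eq_bigr => k _.
have mapC (x : R) : mps_map (@tofrac R) (mpsC n x) = mpsC n x%:F.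
  by apply: mpsP => m' /=; case: eqP => // _; rewrite rmorph0.
have pk0 : (p%:R : K) ^+ k.+1 != 0 by rewrite expf_neq0.
have P0 : mpsC n ((p%:R : K) ^+ k.+1) != 0.
  apply/eqP => /(congr1 (fun h : mps n K => h 0%MM)); rewrite mps_coef0 /= eqxx.
  exact/eqP.
have GEk := congr1 (mps_map (@tofrac R)) (GE k).
rewrite rmorphB !rmorphM !rmorphXn /= !mapC frob_map rmorph_nat in GEk.
have PE : p%:R ^+ k.+1 = mpsC n ((p%:R : K) ^+ k.+1) by rewrite rmorphXn rmorph_nat.
have S1 : p%:R ^+ k.+1 * ((c (bump 0 k))%:F / p%:R ^+ bump 0 k) = (c k.+1)%:F.
  by rewrite /bump leq0n add1n mulrC divfK.
have S2 : p%:R ^+ k.+1 * (u%:F / p%:R) * ((c k)%:F / p%:R ^+ k) = u%:F * (c k)%:F.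
  have cancel (P q x t : K) : P != 0 -> q != 0 -> P * q * (x / P) * (t / q) = x * t.
    by move=> P1 q1; field; rewrite P1 q1.
  by rewrite exprS cancel ?expf_neq0.
apply: (mulfI P0); rewrite -[in RHS]PE -GEk mulrBr !mulrA -!(rmorphM (@mpsC n K)).
by rewrite S1 S2.
Qed.

Lemma integral_log_step N (h : mps n K) F : (0 < N)%N -> h 0%MM = 0 ->
    mps_integral (twist h) -> F 0%MM = 0 ->
    mps_ordge N (ell (mps_map (@tofrac R) F) - h) ->
  exists F' : mps n R, [/\ F' 0%MM = 0, mps_ordge N (F' - F) &
    mps_ordge N.+1 (ell (mps_map (@tofrac R) F') - h)].
Proof.
move=> N0 h0 [H HE] F0 FN; set r := ell _ - h in FN.
have [F1 F1E] := twist_log F0.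
have rE : twist r = mps_map (@tofrac R) (F1 - H) by rewrite twistB F1E HE rmorphB.
have /choice [a aE] m : exists a, mdeg m = N -> r m = a%:F.
  exists ((F1 - H) m) => mN; rewrite -[RHS]/(mps_map (@tofrac R) (F1 - H) m) -rE.
  by rewrite /twist [RHS]mps_coefB mpsC_mulE (frob_ordge p_pr N0 FN) ?mN // mulr0 subr0.
pose D : mps n R := MPS (fun m => if mdeg m == N then a m else 0).
have D0 : D 0%MM = 0 by rewrite /= mdeg0 ltn_eqF.
have DN : mps_ordge N D by move=> m mN; rewrite /= ltn_eqF.
have FD0 : (F - D) 0%MM = 0 by rewrite mps_coefB F0 D0 subrr.
exists (F - D); split=> //; first by rewrite addrC addrA addNr sub0r; apply: ordgeN.
have mDN : mps_ordge N (mps_map (@tofrac R) (F - D) - mps_map (@tofrac R) F).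
  by rewrite -rmorphB addrC addrA addNr sub0r => m mN; rewrite /= ltn_eqF ?oppr0 ?rmorph0.
have := log_subst_first p_pr (c := fun k => (c k)%:F) cF0 (map_coef0 FD0) (map_coef0 F0) mDN.
have E : mps_ordge N.+1 (r - mps_map (@tofrac R) D).
  move=> m; rewrite ltnS leq_eqVlt [LHS]mps_coefB -[mps_map _ D m]/(D m)%:F => /orP [/eqP mN|mN].
    have -> : D m = a m by rewrite /= mN eqxx.
    by rewrite -aE ?subrr.
  by rewrite FN // DN // rmorph0 subrr.
by move/ordgeD/(_ E); congr mps_ordge; rewrite /r rmorphB; ring.
Qed.

Theorem integral_log_preimage (h : mps n K) : h 0%MM = 0 -> mps_integral (twist h) ->
  exists F, F 0%MM = 0 /\ ell (mps_map (@tofrac R) F) = h.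
Proof.
move=> h0 hi.
pose good N F := F 0%MM = 0 /\ mps_ordge N.+1 (ell (mps_map (@tofrac R) F) - h).
have /choice [next nextP] : forall NF : nat * mps n R, exists F', good NF.1 NF.2 ->
    good NF.1.+1 F' /\ mps_ordge NF.1.+1 (F' - NF.2).
  move=> [N F] /=; have [[F0 FN]|] := pselect (good N F); last by exists 0.
  by have [F' [? ? ?]] := integral_log_step (ltn0Sn N) h0 hi F0 FN; exists F'.
pose s := fix s N := if N is N'.+1 then next (N', s N') else 0.
have sP N : good N (s N).
  elim: N => [|N IH]; last by case: (nextP (N, s N) IH).
  by split; [apply: mps_coef0|apply/ordge_coef0; rewrite mps_coefB h0 subr0 subst_coef0 log_coef0].
have sN j k : mps_ordge j.+1 (s (j + k)%N - s j).
  elim: k => [|k IH]; first by rewrite addn0 subrr; apply: ordge0.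
  apply: ordge_trans IH; rewrite addnS; have [_] := nextP (_, _) (sP (j + k)%N).
  by apply: ordgeW; rewrite ltnS leq_addr.
exists (MPS (fun m => s (mdeg m) m)); set F := MPS _.
have FN N : mps_ordge N.+1 (F - s N).
  apply: eq_ordge => m; rewrite ltnS => mN; apply: esym.
  by rewrite -(subnKC mN); apply: ordge_eq (sN _ _) _.
have F0 : F 0%MM = 0 by rewrite /F /= mdeg0 mps_coef0.
split=> //; apply: ordge_ext => N; apply: (ordgeW (leqnSn N)).
have [s0 sh] := sP N; apply: ordge_trans sh.
apply: (log_subst_cong p_pr (c := fun k => (c k)%:F) cF0) => //; try exact: map_coef0.
by rewrite -rmorphB => m mN; rewrite -[LHS]/(((F - s N) m)%:F) FN // rmorph0.
Qed.
End FunctionalEquation.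

(** * Formal group laws from logarithms *)

Lemma tuple2_coef0 k (R : comNzRingType) (a b : mps k R) :
  a 0%MM = 0 -> b 0%MM = 0 -> forall j, tnth [tuple a; b] j 0%MM = 0.
Proof. by move=> a0 b0; case=> [[|[|]]]. Qed.

Section LogarithmToFormalGroup.
Context (p : nat) (p_pr : prime p) (R : idomainType) (c : nat -> {fraction R}).
Hypothesis c0 : c 0%N = 1.
Local Notation K := {fraction R}.
Local Notation l := (p_power_series p c).
Local Notation ell f := (mps_subst l [tuple f]).
Local Notation toK := (mps_map (@tofrac R)).

Lemma mpsX0 n i : mpsX R (i : 'I_n) 0%MM = 0.
Proof. by rewrite /= eq_sym mnm1_eq0. Qed.

Section Laws.
Context (L : mps 2 R).
Hypothesis L0 : L 0%MM = 0.
Hypothesis logL : ell (toK L) =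
  mps_subst l [tuple mpsX K (0 : 'I_2)] + mps_subst l [tuple mpsX K (1 : 'I_2)].

Lemma log_law n (a b : mps n R) : a 0%MM = 0 -> b 0%MM = 0 ->
  ell (toK (mps_subst L [tuple a; b])) = ell (toK a) + ell (toK b).
Proof.
move=> a0 b0; have toK0 (f : mps n R) : f 0%MM = 0 -> toK f 0%MM = 0.
  by rewrite /= => ->; rewrite rmorph0.
have t0 := tuple2_coef0 (toK0 _ a0) (toK0 _ b0).
have X0 (i : 'I_2) : forall j, tnth [tuple mpsX K i] j 0%MM = 0.
  by move=> j; rewrite (ord1 j) /= eq_sym mnm1_eq0.
have := congr1 (fun f => mps_subst f [tuple toK a; toK b]) logL.
rewrite -[RHS]/(substm t0 (_ + _)) rmorphD /= !substmE.
rewrite !subst_comp ?tuple1E //; last first.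
  by apply: tnth1_coef0; rewrite /= L0 rmorph0.
by rewrite mps_map_subst tuple2E !substX.
Qed.

Lemma toK_log_inj n (a b : mps n R) : a 0%MM = 0 -> b 0%MM = 0 ->
  ell (toK a) = ell (toK b) -> a = b.
Proof.
move=> a0 b0 H; apply: (mps_map_inj (@tofrac_inj R)).
by apply: (log_subst_inj p_pr c0) H; rewrite /= ?a0 ?b0 rmorph0.
Qed.

Lemma log_formal_group_law : formal_group_law L.
Proof.
have z0 n : (0 : mps n R) 0%MM = 0 by rewrite mps_coef0.
have ell0 n : ell (toK (0 : mps n R)) = 0 by rewrite rmorph0 log_subst0.
have s0 n (t : 2.-tuple (mps n R)) : mps_subst L t 0%MM = 0 by rewrite subst_coef0.
split; apply: toK_log_inj; rewrite ?s0 ?mpsX0 //; rewrite !log_law ?s0 ?mpsX0 //.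
- by rewrite ell0 addr0.
- by rewrite ell0 add0r.
- exact/esym/addrA.
- by rewrite logL addrC !mps_mapX.
Qed.

Lemma log_is_logarithm : is_logarithm L l.
Proof. by split; [exact: log_coef0|exact: log_coef1|]. Qed.
End Laws.

Lemma formal_group_law_coef0 (L : mps 2 R) : formal_group_law L -> L 0%MM = 0.
Proof.
move=> [/(congr1 (fun f : mps 1 R => f 0%MM)) + _ _ _].
by rewrite subst_coef0 mpsX0.
Qed.

Lemma logarithm_unique (L M : mps 2 R) : L 0%MM = 0 -> M 0%MM = 0 ->
  is_logarithm L l -> is_logarithm M l -> L = M.
Proof.
by move=> L0 M0 [_ _ EL] [_ _ EM]; apply: toK_log_inj => //; rewrite EL EM.
Qed.
End LogarithmToFormalGroup.

Lemma formal_group_iso_refl (R : comUnitRingType) (L : mps 2 R) :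
  L 0%MM = 0 -> formal_group_iso L L.
Proof.
move=> L0; exists (mpsX R ord0); split; first by rewrite /= eq_sym mnm1_eq0.
  by rewrite /= eqxx unitr1.
have X0 (i : 'I_2) : forall j, tnth [tuple mpsX R i] j 0%MM = 0.
  by move=> j; rewrite (ord1 j) /= eq_sym mnm1_eq0.
rewrite !substX //; last by move=> j; rewrite (ord1 j).
by rewrite -[LHS]/L -[LHS](subst_id L) tuple2E.
Qed.

Section IntegralFormalGroup.
Context (p : nat) (p_pr : prime p) (R : idomainType).
Hypothesis p_neq0 : (p%:R : R) != 0.
Hypothesis fermat : forall x : R, nat_dvd p (x ^+ p - x).
Context (c : nat -> R) (u : R).
Hypothesis c0 : c 0%N = 1.
Hypothesis cu : forall k, exists y, c k.+1 - u * c k = p%:R ^+ k.+1 * y.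
Local Notation l := (p_power_series p (fun k => tofrac (c k))).

Lemma integral_formal_group : exists L : mps 2 R,
  formal_group_law L /\ is_logarithm L l.
Proof.
have cF0 : tofrac (c 0%N) = 1 by rewrite c0 rmorph1.
pose ellX i := mps_subst l [tuple mpsX {fraction R} (i : 'I_2)].
have tw i : mps_integral (twist p u (ellX i)).
  rewrite /ellX -(mps_mapX (@tofrac R)); apply: twist_log => //.
  by rewrite /= eq_sym mnm1_eq0.
have [||L [L0 LE]] := @integral_log_preimage p p_pr R p_neq0 fermat c u c0 cu 2
   (ellX 0 + ellX 1).
- by rewrite mps_coefD !subst_coef0 log_coef0 addr0.
- have [[F FE] [G GE]] := (tw 0, tw 1).
  by exists (F + G); rewrite twistD // FE GE rmorphD.
exists L; split; first exact: (log_formal_group_law p_pr (c := fun k => tofrac (c k)) cF0 L0).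
exact: (log_is_logarithm p_pr (c := fun k => tofrac (c k)) cF0).
Qed.
End IntegralFormalGroup.

(** * Perfect powers of polynomials *)

Section CoprimePowers.
Context (K : fieldType).
Implicit Types (p q r : {poly K}).

Lemma coprimep_mul_exp (d : nat) p q r : r != 0 -> coprimep p q -> p * q = r ^+ d.+1 ->
  exists g, p %= g ^+ d.+1.
Proof.
move=> r0 cpq E; pose g := gcdp p r; exists g.
have g0 : g != 0 by rewrite gcdp_eq0 negb_and r0 orbT.
have [pE rE] := (divpK (dvdp_gcdl p r), divpK (dvdp_gcdr p r)); rewrite -/g in pE rE.
set p1 := p %/ g in pE; set r1 := r %/ g in rE.
have c1 : coprimep p1 r1 by apply: coprimep_div_gcd; rewrite r0 orbT.
have E1 : p1 * q = g ^+ d * r1 ^+ d.+1.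
  by apply: (mulfI g0); rewrite mulrA [g * p1]mulrC pE E -[in LHS]rE exprMn mulrC (exprS g) mulrA.
have d1 : p1 %| g ^+ d.
  by rewrite -(Gauss_dvdpl _ (coprimep_expr d.+1 c1)) -E1 dvdp_mulr.
have cgq : coprimep (g ^+ d) q.
  by apply: coprimep_expl; apply: coprimep_dvdr cpq; apply: dvdp_gcdl.
have d2 : g ^+ d %| p1 by rewrite -(Gauss_dvdpl _ cgq) E1 dvdp_mulr.
by rewrite -pE exprSr eqp_mul2r // /eqp d1 d2.
Qed.

Lemma eqp_pow_coprime (d e : nat) p g : (0 < d)%N -> (0 < e)%N -> coprime e d -> p != 0 ->
  p ^+ e %= g ^+ d -> exists r, p %= r ^+ d.
Proof.
move=> d0 e0 ced p0 pg.
have [u v Euv _] := egcdnP d e0; rewrite (eqP ced) in Euv.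
have E : p ^+ (u * e) %= (g ^+ u) ^+ d.
  have -> : p ^+ (u * e) = (p ^+ e) ^+ u by rewrite -exprM mulnC.
  have -> : (g ^+ u) ^+ d = (g ^+ d) ^+ u by rewrite -!exprM mulnC.
  exact: eqp_exp.
have pv0 : (p ^+ v) ^+ d != 0 by rewrite !expf_neq0.
have E2 : p * (p ^+ v) ^+ d %= (g ^+ u) ^+ d.
  by rewrite -exprM -exprS -addn1 -Euv.
have dv : p ^+ v %| g ^+ u.
  by rewrite -(dvdp_pexp2r _ _ d0) -(eqp_dvdr _ E2) dvdp_mull.
exists (g ^+ u %/ p ^+ v).
by rewrite -(eqp_mul2r _ _ pv0) -exprMn divpK.
Qed.

Lemma coprime_power_equation (d e e' : nat) p q r :
    (0 < e)%N -> coprime e d.+1 -> r != 0 -> p != 0 -> coprimep p q ->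
  p ^+ e * q ^+ e' = r ^+ d.+1 -> exists g, p %= g ^+ d.+1.
Proof.
move=> e0 ced r0 p0 cpq E.
have [g pg] := coprimep_mul_exp r0 (coprimep_expl e (coprimep_expr e' cpq)) E.
exact: eqp_pow_coprime pg.
Qed.

Lemma dvdp_deriv_exp (n : nat) p g : g ^+ n.+1 %| p -> g ^+ n %| p^`().
Proof.
case/dvdpP => q ->; rewrite derivM; apply: dvdp_add.
  by apply: dvdp_mull; apply: dvdp_exp2l.
rewrite deriv_exp /= -mulr_natr mulrA; apply: dvdp_mulr.
by apply: dvdp_mull; apply: dvdp_mull.
Qed.

(* Both [phi] and [phi - 1] would be perfect d-th powers up to constants, and
   then [phi'] has more zeros than its degree allows. *)
Lemma no_polynomial_parametrization (a b d : nat) (phi psi : {poly K}) :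
    (forall n, n.+1%:R != 0 :> K) -> (1 < d)%N -> (0 < a)%N -> (0 < b)%N ->
    coprime a d -> coprime b d ->
    psi ^+ d = phi ^+ a * (phi - 1) ^+ b ->
  (size phi <= d.+1)%N -> (size phi <= 1)%N.
Proof.
move=> char0; case: d => [|[|d]] // _ a0 b0 cad cbd E sd.
rewrite leqNgt; apply/negP => s1.
have phi0 : phi != 0 by rewrite -size_poly_gt0 (leq_trans _ s1).
have s1' : size (phi - 1) = size phi by rewrite size_polyDl // size_polyN size_poly1.
have phi10 : phi - 1 != 0 by rewrite -size_poly_gt0 s1' (leq_trans _ s1).
have psi0 : psi != 0.
  have : psi ^+ d.+2 != 0 by rewrite E mulf_neq0 ?expf_neq0.
  by apply: contraNneq => ->; rewrite expr0n.
have cp : coprimep phi (phi - 1).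
  apply/Bezout_coprimepP; exists (1, -1) => /=.
  by rewrite mul1r mulN1r opprB addrC subrK eqpxx.
have [g1 e1] := coprime_power_equation a0 cad psi0 phi0 cp (esym E).
rewrite mulrC in E; rewrite coprimep_sym in cp.
have [g2 e2] := coprime_power_equation b0 cbd psi0 phi10 cp (esym E).
have sg p g : (1 < size p)%N -> p %= g ^+ d.+2 -> (1 < size g)%N.
  move=> sp /eqp_size pg; rewrite ltnNge; apply: contraL sp => sg.
  rewrite -leqNgt pg (size1_polyC sg) -polyC_exp size_polyC; exact: leq_b1.
have sg1 := sg _ _ s1 e1; have sg2 : (1 < size g2)%N by apply: sg e2; rewrite s1'.
have d1 : g1 ^+ d.+1 %| phi^`().
  by apply: dvdp_deriv_exp; case/andP: e1.
have d2 : g2 ^+ d.+1 %| phi^`().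
  have -> : phi^`() = (phi - 1)^`() by rewrite derivB derivC subr0.
  by apply: dvdp_deriv_exp; case/andP: e2.
have cg : coprimep (g1 ^+ d.+1) (g2 ^+ d.+1).
  apply/coprimep_expl/coprimep_expr; rewrite coprimep_sym.
  move: cp; rewrite (eqp_coprimepl _ e2) (eqp_coprimepr _ e1).
  by rewrite coprimep_pexpl // coprimep_pexpr.
have dphi0 : phi^`() != 0.
  apply/eqP => /(congr1 (fun q : {poly K} => q`_((size phi).-2))).
  case s : (size phi) s1 => [|[|n]] // _ /=; rewrite coef_deriv coef0 -mulr_natr.
  move/eqP; rewrite mulf_eq0 (negPf (char0 n)) orbF => /eqP H.
  by move: phi0; rewrite -lead_coef_eq0 /lead_coef s /= H eqxx.
have := dvdp_leq dphi0 (_ : g1 ^+ d.+1 * g2 ^+ d.+1 %| phi^`()).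
rewrite Gauss_dvdp // d1 d2 => /(_ isT).
have nz (g : {poly K}) : (1 < size g)%N -> g ^+ d.+1 != 0.
  by move=> s; rewrite expf_neq0 // -size_poly_gt0 (leq_trans _ s).
have sX (g : {poly K}) : (1 < size g)%N -> (d.+1 < size (g ^+ d.+1))%N.
  move=> s; have := size_exp g d.+1; have : (0 < size (g ^+ d.+1))%N.
    by rewrite size_poly_gt0 nz.
  by case: (size (g ^+ _)) => // m _ /= ->; rewrite ltnS leq_pmull // -ltnS prednK // (leq_trans _ s).
rewrite size_mul ?nz //; move: (lt_size_deriv phi0) (sX _ sg1) (sX _ sg2) sd.
move: (size phi^`()) (size phi) (size (g1 ^+ d.+1)) (size (g2 ^+ d.+1)); lia.
Qed.
End CoprimePowers.

(** * Existence of valuation rings *)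

Definition subring_pred (F : fieldType) (O : F -> Prop) :=
  O 1 /\ forall f g, O f -> O g -> O (f - g) /\ O (f * g).

Section SubringPred.
Context (F : fieldType) (O : F -> Prop).
Hypothesis Oring : subring_pred O.

Lemma subring1 : O 1. Proof. by case: Oring. Qed.

Lemma subringM f g : O f -> O g -> O (f * g).
Proof. by move=> Of Og; case: Oring => _ /(_ f g Of Og) []. Qed.

Lemma subringB f g : O f -> O g -> O (f - g).
Proof. by move=> Of Og; case: Oring => _ /(_ f g Of Og) []. Qed.

Lemma subring0 : O 0.
Proof. by rewrite -(subrr 1); apply: subringB; apply: subring1. Qed.

Lemma subringN f : O f -> O (- f).
Proof. by move=> Of; rewrite -sub0r; apply: subringB => //; apply: subring0. Qed.

Lemma subringN1 : O (- 1).
Proof. exact/subringN/subring1. Qed.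

Lemma subringD f g : O f -> O g -> O (f + g).
Proof. by move=> Of Og; rewrite -[g]opprK; apply: subringB => //; apply: subringN. Qed.

Lemma subringX f n : O f -> O (f ^+ n).
Proof.
by move=> Of; elim: n => [|n IH]; rewrite ?expr0 ?exprS; [apply: subring1|apply: subringM].
Qed.

Lemma subring_sum I (r : seq I) (P : pred I) (a : I -> F) :
  (forall i, P i -> O (a i)) -> O (\sum_(i <- r | P i) a i).
Proof.
move=> H; elim/big_rec: _ => [|i x Pi]; first exact: subring0.
by apply: subringD; apply: H.
Qed.
End SubringPred.

Section SpanOfPowers.
Context (F : fieldType) (O : F -> Prop) (t : F).
Hypothesis Oring : subring_pred O.

Definition pow_span n v := exists a : nat -> F,
  (forall i, O (a i)) /\ v = \sum_(i < n) a i * t ^+ i.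

Lemma pow_spanD n v w : pow_span n v -> pow_span n w -> pow_span n (v + w).
Proof.
move=> [a [Oa ->]] [b [Ob ->]]; exists (fun i => a i + b i); split.
  by move=> i; apply: subringD.
by rewrite -big_split; apply: eq_bigr => i _; rewrite mulrDl.
Qed.

Lemma pow_spanM n v x : O x -> pow_span n v -> pow_span n (x * v).
Proof.
move=> Ox [a [Oa ->]]; exists (fun i => x * a i); split.
  by move=> i; apply: subringM.
by rewrite mulr_sumr; apply: eq_bigr => i _; rewrite mulrA.
Qed.

Lemma pow_span_pow n k : (k < n)%N -> pow_span n (t ^+ k).
Proof.
move=> kn; exists (fun i => (i == k)%:R); split=> [i|].
  by case: eqP => _; [apply: subring1|apply: subring0].
rewrite (bigD1 (Ordinal kn)) //= eqxx mul1r big1 ?addr0 // => i.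
by rewrite -val_eqE /= => /negPf ->; rewrite mul0r.
Qed.

Lemma pow_span_sum n I (r : seq I) (v : I -> F) :
  (forall i, pow_span n (v i)) -> pow_span n (\sum_(i <- r) v i).
Proof.
move=> H; elim/big_rec: _ => [|i x _]; last exact: pow_spanD.
exists (fun=> 0); split=> [i|]; first exact: subring0.
by rewrite big1 // => i _; rewrite mul0r.
Qed.

Lemma pow_spanW n m v : (n <= m)%N -> pow_span n v -> pow_span m v.
Proof.
move=> nm [a [Oa ->]]; apply: pow_span_sum => i; apply: pow_spanM => //.
by apply: pow_span_pow; apply: leq_trans nm.
Qed.

Lemma pow_span_mul n m v w : pow_span n v -> pow_span m w -> pow_span (n + m) (v * w).
Proof.
move=> [a [Oa ->]] [b [Ob ->]]; rewrite mulr_suml; apply: pow_span_sum => i.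
rewrite mulr_sumr; apply: pow_span_sum => j.
rewrite mulrACA -exprD; apply: pow_spanM; first exact: subringM.
by apply: pow_span_pow; rewrite -addnS leq_add // ltnW.
Qed.

Definition adjoin v := exists n, pow_span n v.

Lemma adjoin_subring : subring_pred adjoin.
Proof.
split=> [|v w [n Hv] [m Hw]].
  by exists 1%N; rewrite -(expr0 t); apply: pow_span_pow.
split; last by exists (n + m)%N; apply: pow_span_mul.
exists (n + m)%N; apply: pow_spanD; first by apply: pow_spanW Hv; apply: leq_addr.
rewrite -mulN1r; apply: pow_spanM; first by apply: subringN => //; apply: subring1.
by apply: pow_spanW Hw; rewrite leq_addl.
Qed.

Lemma adjoin_base x : O x -> adjoin x.
Proof.
by move=> Ox; exists 1%N; rewrite -[x]mulr1 -(expr0 t); apply: pow_spanM => //;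
  apply: pow_span_pow.
Qed.

Lemma adjoin_gen : adjoin t.
Proof. by exists 2%N; rewrite -(expr1 t); apply: pow_span_pow. Qed.

Lemma pow_span_reduce n m v : (m <= n)%N -> pow_span m (t ^+ m) ->
  pow_span n.+1 v -> pow_span n v.
Proof.
move=> mn [b [Ob tm]] [a [Oa ->]]; rewrite big_ord_recr /=; apply: pow_spanD.
  by exists a.
apply: pow_spanM => //; rewrite -(subnK mn) exprD tm mulr_sumr subnK //.
apply: pow_span_sum => i; rewrite mulrCA -exprD; apply: pow_spanM => //.
by apply: pow_span_pow; rewrite -[X in (_ < X)%N](subnK mn) ltn_add2l.
Qed.
End SpanOfPowers.

Lemma subring_Zorn (F : fieldType) (S : F -> Prop) (h : F) :
    subring_pred S -> ~ S h ->
  exists O : F -> Prop, [/\ subring_pred O, forall f, S f -> O f, ~ O h &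
    forall B : F -> Prop, subring_pred B -> (forall f, O f -> B f) -> ~ B h ->
      forall f, B f -> O f].
Proof.
move=> Sring Sh.
pose good (A : F -> Prop) := subring_pred (fun f => A f \/ S f) /\ ~ (A h \/ S h).
have [C chain|A [[Aring Ah] maxA]] := @classical_sets.Zorn_bigcup F good.
  move=> tot; split; last by case=> // -[X CX Xh]; case: (chain X CX) => _; apply; left.
  split=> [|f g]; first by right; apply: subring1.
  have closed X : C X -> X f \/ S f -> X g \/ S g ->
      ((exists2 Y, C Y & Y (f - g)) \/ S (f - g)) /\
      ((exists2 Y, C Y & Y (f * g)) \/ S (f * g)).
    move=> CX Hf Hg; have [ring _] := chain X CX.
    case: (subringB ring Hf Hg) => HB; case: (subringM ring Hf Hg) => HM;
      split; try (by right); by left; exists X.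
  move=> [[X CX Xf]|Sf] [[Y CY Yg]|Sg].
  - case: (tot X Y CX CY) => XY.
      by apply: (closed Y CY); left=> //; apply: XY.
    by apply: (closed X CX); left=> //; apply: XY.
  - by apply: (closed X CX); [left|right].
  - by apply: (closed Y CY); [right|left].
  - by split; right; [apply: subringB|apply: subringM].
exists (fun f => A f \/ S f); split=> //; first by right.
move=> B Bring AB Bh f Bf; apply: contrapT => Af.
apply: (maxA B).
  split=> [|BA]; first by move=> g Ag; apply: AB; left.
  by apply: Af; left; apply: BA.
have BS g : (B g \/ S g) <-> B g by split=> [[|Sg]|] //; [apply: AB; right|left].
split; last by rewrite BS.
by have -> : (fun g => B g \/ S g) = B by apply/funext => g; apply/propext.
Qed.

Lemma exists_valuation_ring (F : fieldType) (S : F -> Prop) (h : F) :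
    subring_pred S -> S h^-1 -> ~ S h ->
  exists O : F -> Prop, [/\ subring_pred O, forall f, S f -> O f, ~ O h &
    forall f, O f \/ O f^-1].
Proof.
move=> Sring Ss Sh; have [O [Oring SO Oh maxO]] := subring_Zorn Sring Sh.
exists O; split=> // t.
have h0 : h != 0 by apply: contra_notN Sh => /eqP ->; apply: subring0.
set s := h^-1; have Os : O s := SO _ Ss.
have sN1 r : O r -> s * r != 1.
  by move=> Or; apply: contra_notN Oh => /eqP E; rewrite -[h]mulr1 -E mulrA divff ?mul1r.
have unitO r : O r -> O (1 + s * r)^-1.
  move=> Or.
  pose B f := exists a r', [/\ O a, O r' & f = a / (1 + s * r')].
  have den r' : O r' -> 1 + s * r' != 0.
    move=> Or'; rewrite addrC addr_eq0; apply: contraTN (sN1 (- r') (subringN Oring Or')).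
    by move=> /eqP E; rewrite negbK mulrN E opprK.
  apply: (maxO B).
  - split=> [|f g [a [r1 [Oa Or1 ->]]] [b [r2 [Ob Or2 ->]]]].
      by exists 1, 0; rewrite mulr0 addr0 divr1; split=> //; [apply: subring1|apply: subring0].
    have Or3 : O (r1 + r2 + s * r1 * r2).
      by do ![apply: subringD => //|apply: subringM => //].
    have E : 1 + s * (r1 + r2 + s * r1 * r2) = (1 + s * r1) * (1 + s * r2) by ring.
    have [d1 d2] := (den _ Or1, den _ Or2).
    split.
      exists (a * (1 + s * r2) - b * (1 + s * r1)), (r1 + r2 + s * r1 * r2); split=> //.
        by do ![exact: subring1|apply: subringB => //|apply: subringD => //|apply: subringM => //].
      by rewrite E; field; rewrite d1 d2.
    exists (a * b), (r1 + r2 + s * r1 * r2); split=> //; first exact: subringM.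
    by rewrite E; field; rewrite d1 d2.
  - move=> f Of; exists f, 0; rewrite mulr0 addr0 divr1; split=> //; exact: subring0.
  - move=> [a [r' [Oa Or' E]]].
    have E2 : h * (1 + s * r') = a by rewrite E divfK ?den.
    have /eqP [] := sN1 (a - r') (subringB Oring Oa Or').
    by rewrite -E2 mulrBr mulrA mulVf // mul1r addrK.
  - by exists 1, r; rewrite div1r; split=> //; apply: subring1.
have adjoin_h v : ~ O v -> adjoin O v h.
  move=> Ov; apply: contrapT => nh; apply: Ov.
  apply: (maxO _ (adjoin_subring v Oring)) => //; last exact: adjoin_gen.
  by move=> f; apply: adjoin_base.
(* [h] in the span of the first powers of [v] makes [v^-1] integral over [O]. *)
have integral v m : v != 0 -> pow_span O v m.+1 h -> pow_span O v^-1 m (v^-1 ^+ m).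
  move=> v0 [a [Oa hE]].
  have hE' : 1 - s * a 0%N = \sum_(i < m) s * a i.+1 * v ^+ i.+1.
    rewrite -[1](mulVf h0) -/s [in X in X - _]hE big_ord_recl expr0 mulr1 mulrDr addrC addKr.
    by rewrite mulr_sumr; apply: eq_bigr => i _; rewrite lift0 mulrA.
  have Ou := unitO (- a 0%N) (subringN Oring (Oa _)).
  have u0 : 1 - s * a 0%N != 0.
    rewrite subr_eq0 eq_sym; exact: sN1.
  have pw k : (k <= m)%N -> v ^+ k * v^-1 ^+ m = v^-1 ^+ (m - k).
    by move=> km; rewrite -{1}(subnK km) exprD mulrCA -exprMn divff // expr1n mulr1.
  rewrite mulrN in Ou; set w := (1 - s * a 0%N)^-1 in Ou.
  have -> : v^-1 ^+ m = w * \sum_(i < m) s * a i.+1 * v^-1 ^+ (m - i.+1).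
    apply: (canRL (mulKf u0)); rewrite hE' mulr_suml.
    by apply: eq_bigr => i _; rewrite -[LHS]mulrA pw.
  apply: pow_spanM => //; apply: pow_span_sum => // i; apply: pow_spanM => //.
    exact: subringM.
  by apply: pow_span_pow => //; have := ltn_ord i; lia.
apply: contrapT => H; have {H}[nt nt'] : ~ O t /\ ~ O t^-1 by split=> Ot; apply: H; [left|right].
have t0 : t != 0 by apply: contra_notN nt => /eqP ->; apply: subring0.
have nh0 v : ~ pow_span O v 1 h.
  by move=> [a [Oa]]; rewrite big_ord1 expr0 mulr1 => hE; apply: Oh; rewrite hE.
have [n Hn] := adjoin_h _ nt; have [m Hm] := adjoin_h _ nt'.
have [N leN] := ubnP (n + m)%N; elim: N => // N IH in t t0 n m Hn Hm leN {nt nt'} *.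
wlog mn : t t0 n m Hn Hm leN / (m <= n)%N.
  move=> W; have [mn|/ltnW nm] := leqP m n; first exact: (W t t0 n m).
  have tV : t^-1 != 0 by rewrite invr_eq0.
  have Hn' : pow_span O t^-1^-1 n h by rewrite invrK.
  by rewrite addnC in leN; apply: (W _ tV m n Hm Hn').
case: m mn Hm leN => [|m] mn Hm leN.
  by apply: (nh0 t^-1); apply: pow_spanW Hm.
case: n mn Hn leN => [|n] mn Hn leN //.
have := integral t^-1 m; rewrite invr_eq0 invrK => /(_ t0 Hm) tm.
apply: (IH t t0 n m.+1) => //.
exact: pow_span_reduce tm Hn.
Qed.

(** * Places where x has a pole *)

Section NonUnits.
Context (F : fieldType) (O : F -> Prop) (Oring : subring_pred O).
Hypothesis Oval : forall f, f != 0 -> O f \/ O f^-1.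
Implicit Types (f g e : F).

Definition nonunit f := O f /\ forall g, O g -> f * g <> 1.

Lemma nonunit0 : nonunit 0.
Proof.
split=> [|g _]; first exact: subring0.
by rewrite mul0r => /esym/eqP; rewrite oner_eq0.
Qed.

Lemma nonunitM f g : O f -> nonunit g -> nonunit (f * g).
Proof.
move=> Of [Og gN]; split=> [|h Oh]; first exact: subringM.
by rewrite [f * g]mulrC -mulrA; apply: gN; apply: subringM.
Qed.

Lemma nonunit_invN f : f != 0 -> ~ O f^-1 -> nonunit f.
Proof.
move=> f0 fN; split=> [|g Og E]; first by case: (Oval f0).
by apply: fN; rewrite -[f^-1]mulr1 -E mulKf.
Qed.

Lemma nonunitD f g : nonunit f -> nonunit g -> nonunit (f + g).
Proof.
wlog fg : f g / O (f / g) => [W|] nf ng.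
  have [->|f0] := eqVneq f 0; first by rewrite add0r.
  have [->|g0] := eqVneq g 0; first by rewrite addr0.
  have fg0 : f / g != 0 by rewrite mulf_neq0 ?invr_eq0.
  have [fg|gf] := Oval fg0; first exact: W.
  by rewrite addrC; apply: W => //; rewrite -invf_div.
have [->|g0] := eqVneq g 0; first by rewrite addr0.
have -> : f + g = (f / g + 1) * g by rewrite mulrDl divfK ?mul1r.
by apply: nonunitM => //; apply: subringD => //; apply: subring1.
Qed.

Lemma nonunit_sum I (r : seq I) (P : pred I) (a : I -> F) :
  (forall i, P i -> nonunit (a i)) -> nonunit (\sum_(i <- r | P i) a i).
Proof.
by move=> H; elim/big_rec: _ => [|i x Pi]; [apply: nonunit0|apply: nonunitD; apply: H].
Qed.

Lemma nonunitN f : nonunit f -> nonunit (- f).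
Proof.
by move=> nf; rewrite -mulN1r; apply: nonunitM => //; apply: subringN1.
Qed.

Lemma unit1D e : nonunit e -> 1 + e != 0 /\ O (1 + e)^-1.
Proof.
move=> ne; have [Oe eN] := ne.
have e0 : 1 + e != 0.
  apply/eqP => E; apply: (eN (-1)); first by apply: subringN1.
  by rewrite mulrN1; apply/eqP; rewrite -subr_eq0 -opprD addrC E oppr0.
split=> //; apply: contrapT => H.
have /(nonunitD (nonunitN ne)) := nonunit_invN e0 H.
rewrite addrC addrK => -[_ /(_ 1 (subring1 Oring))]; rewrite mulr1; exact.
Qed.

Lemma valuation_root n f : O (f ^+ n.+1) -> O f.
Proof.
move=> Ofn; have [->|f0] := eqVneq f 0; first exact: subring0.
case: (Oval f0) => // OfV; have -> : f = f ^+ n.+1 * f^-1 ^+ n.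
  by rewrite exprS -mulrA -exprMn divff // expr1n mulr1.
by apply: subringM => //; apply: subringX.
Qed.

Lemma nonunitX n f : nonunit f -> nonunit (f ^+ n.+1).
Proof. by move=> nf; rewrite exprSr; apply: nonunitM => //; apply: subringX; case: nf. Qed.
End NonUnits.

Lemma closed_point_subring (K F : fieldType) (c : {rmorphism K -> F}) O :
  closed_point c O -> subring_pred O.
Proof. by case=> Oc Oop _ _; split=> //; rewrite -(rmorph1 c). Qed.

Section CurveAtInfinity.
Context (K F : fieldType) (c : {rmorphism K -> F}) (x y : F) (a b d : nat).
Hypothesis function_field : is_function_field c x y a b d.
Hypothesis d_gt0 : (0 < d)%N.
Hypothesis abd : (a + b = d.+1)%N.
Implicit Types (f g : F) (O : F -> Prop) (P Q : {poly {poly K}}).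

Definition eval_x : {poly K} -> F := horner_eval x \o map_poly c.
HB.instance Definition _ := GRing.RMorphism.copy eval_x (horner_eval x \o map_poly c).

Lemma eval_xE (q : {poly K}) : eval_x q = (map_poly c q).[x]. Proof. by []. Qed.

Lemma eval_xyE P : eval_xy c x y P = (map_poly eval_x P).[y].
Proof. by []. Qed.

Lemma eval_curve : eval_xy c x y (curve_poly K a b d) = 0.
Proof. by apply/(function_field.1); exists 1; rewrite mul1r. Qed.

Lemma curve_eq : y ^+ d = x ^+ a * (x - 1) ^+ b.
Proof.
have := eval_curve; rewrite eval_xyE /curve_poly rmorphB /= map_polyXn map_polyC /=.
rewrite hornerD hornerN hornerXn hornerC => /eqP; rewrite subr_eq0 => /eqP ->.
rewrite rmorphM !rmorphXn rmorphB rmorph1 /= eval_xE map_polyX hornerX //.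
Qed.

Section PoleOfX.
Context (O : F -> Prop).
Hypothesis Oc : closed_point c O.
Hypothesis Ox : ~ O x.

Let Oring := closed_point_subring Oc.
Let Oval : forall f, f != 0 -> O f \/ O f^-1. Proof. by case: Oc. Qed.

Lemma pole_x_neq0 : x != 0.
Proof. by apply: contra_notN Ox => /eqP ->; apply: subring0. Qed.

Lemma nonunit_xV : nonunit O x^-1.
Proof.
by apply: (nonunit_invN Oval); rewrite ?invr_eq0 ?invrK //; apply: pole_x_neq0.
Qed.

Definition unit_part := (1 - x^-1) ^+ b.

Lemma unit_partP : [/\ unit_part != 0, O unit_part & O unit_part^-1].
Proof.
have [H1 H2] := unit1D Oring Oval (nonunitN Oring nonunit_xV).
split; first by rewrite expf_neq0.
  by apply: subringX => //; apply: subringB => //; [apply: subring1|case: nonunit_xV].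
by rewrite -exprVn; apply: subringX.
Qed.

Lemma curve_eq_infty : y ^+ d = x ^+ d.+1 * unit_part.
Proof.
rewrite curve_eq -abd exprD -mulrA; congr (_ * _).
by rewrite /unit_part -exprMn mulrBr mulr1 divff ?pole_x_neq0.
Qed.

Lemma pole_y_neq0 : y != 0.
Proof.
have: y ^+ d != 0.
  have [v0 _ _] := unit_partP; rewrite curve_eq_infty mulf_neq0 //.
  by rewrite expf_neq0 // pole_x_neq0.
by rewrite expf_eq0 d_gt0.
Qed.

Definition monomial (si : nat * nat) := x ^+ si.1 * y ^+ si.2.
Definition pole_order (si : nat * nat) := (d * si.1 + d.+1 * si.2)%N.

Lemma monomial_neq0 si : monomial si != 0.
Proof. by rewrite mulf_neq0 ?expf_neq0 ?pole_x_neq0 ?pole_y_neq0. Qed.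

Lemma monomialX si : monomial si ^+ d = x ^+ pole_order si * unit_part ^+ si.2.
Proof.
rewrite exprMn -(exprM x) -(exprM y) [(si.2 * d)%N]mulnC (exprM y) curve_eq_infty exprMn.
by rewrite mulrA -(exprM x) -exprD [(si.1 * d)%N]mulnC.
Qed.

Lemma monomial_quotX si ti : (pole_order si <= pole_order ti)%N ->
  (monomial si / monomial ti) ^+ d =
  unit_part ^+ si.2 * unit_part^-1 ^+ ti.2 * x^-1 ^+ (pole_order ti - pole_order si).
Proof.
move=> le; have E : x ^+ pole_order ti =
    x ^+ (pole_order ti - pole_order si) * x ^+ pole_order si by rewrite -exprD subnK.
have [v0 _ _] := unit_partP; have x0 := pole_x_neq0.
rewrite exprMn !exprVn !monomialX E.
move: (expf_neq0 (pole_order ti - pole_order si) x0) (expf_neq0 (pole_order si) x0).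
move: (expf_neq0 si.2 v0) (expf_neq0 ti.2 v0).
move: (_ ^+ _) (_ ^+ _) (_ ^+ _) (_ ^+ _) => p q r s p0 q0 r0 s0.
by field; rewrite ?p0 ?q0 ?r0 ?s0.
Qed.

Lemma monomial_quot si ti : (pole_order si <= pole_order ti)%N ->
  O (monomial si / monomial ti).
Proof.
move=> le; have [_ Ov OvV] := unit_partP; have [Ow _] := nonunit_xV.
apply: (@valuation_root _ _ Oring Oval d.-1); rewrite prednK // monomial_quotX //.
by do ![apply: subringM => //|apply: subringX => //].
Qed.

Lemma monomial_quot_nonunit si ti : (pole_order si < pole_order ti)%N ->
  nonunit O (monomial si / monomial ti).
Proof.
move=> lt; have [_ Ov OvV] := unit_partP.
have nq : nonunit O ((monomial si / monomial ti) ^+ d).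
  rewrite monomial_quotX ?(ltnW lt) //; apply: nonunitM => //.
    by apply: subringM => //; apply: subringX.
  by rewrite -subnSK //; apply: nonunitX => //; apply: nonunit_xV.
split; first exact: monomial_quot (ltnW lt).
move=> g Og E; case: nq => _ /(_ (g ^+ d) (subringX Oring _ Og)); apply.
by rewrite -exprMn E expr1n.
Qed.
End PoleOfX.

(* At a place where [x] has a pole, [x^s y^i] has pole order proportional to
   [d s + (d + 1) i], and these values are distinct for [i < d]; so a single
   monomial dominates, the same one at all such places. *)
Lemma leading_monomial P : eval_xy c x y P != 0 ->
  exists (r : K) si, r != 0 /\ forall O, closed_point c O -> ~ O x ->
    exists e, nonunit O e /\ eval_xy c x y P = c r * monomial si * (1 + e).
Proof.
pose C := curve_poly K a b d.
have Cmonic : C \is monic by apply: monicXnsubC.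
pose R := Pdiv.Ring.rmodp P C.
have -> : eval_xy c x y P = eval_xy c x y R.
  rewrite [in LHS](Pdiv.RingMonic.rdivp_eq Cmonic P) !eval_xyE rmorphD rmorphM.
  by rewrite hornerD hornerM -(eval_xyE C) eval_curve mulr0 add0r.
have sR : (size R <= d)%N.
  have sC : size C = d.+1 by apply: size_XnsubC.
  by have := Pdiv.Ring.ltn_rmodp P C; rewrite sC (monic_neq0 Cmonic) ltnS.
move=> R0; pose S := \max_(i < d) size (R`_i)%R.
pose coef (j : 'I_d * 'I_S) := (R`_(j.1))`_(j.2).
pose idx (j : 'I_d * 'I_S) := (nat_of_ord j.2, nat_of_ord j.1).
have RE : eval_xy c x y R = \sum_j c (coef j) * monomial (idx j).
  rewrite eval_xyE (horner_coef_wide (n := d)); last first.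
    exact: leq_trans (size_poly _ _) sR.
  transitivity (\sum_(i < d) \sum_(s < S) c (R`_i)`_s * monomial (nat_of_ord s, nat_of_ord i)).
    apply: eq_bigr => i _; rewrite coef_map /= eval_xE (horner_coef_wide (n := S)).
      by rewrite mulr_suml; apply: eq_bigr => s _; rewrite coef_map /= -mulrA.
    apply: leq_trans (size_poly _ _) _.
    exact: (leq_bigmax_cond (F := fun i : 'I_d => size (R`_i)%R)).
  by rewrite pair_bigA.
have [j0 cj0] : exists j, coef j != 0.
  apply: contrapT => H; case/eqP: R0; rewrite RE big1 // => j _.
  have [->|/eqP cj] := eqVneq (coef j) 0; first by rewrite rmorph0 mul0r.
  by case: H; exists j; apply/eqP.
have [j cj maxj] := @arg_maxnP _ j0 (fun j => coef j != 0) (fun j => pole_order (idx j)) cj0.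
exists (coef j), (idx j); split=> // O Oc Ox.
have Oring := closed_point_subring Oc.
have Oval : forall f, f != 0 -> O f \/ O f^-1 by case: Oc.
exists (\sum_(k | k != j) c (coef k / coef j) * (monomial (idx k) / monomial (idx j))).
have m0 := monomial_neq0 Oc Ox; split.
  apply: nonunit_sum => // k kj.
  have [->|ck] := eqVneq (coef k) 0.
    by rewrite mul0r rmorph0 mul0r; apply: nonunit0.
  apply: nonunitM => //; first by case: Oc.
  have le : (pole_order (idx k) <= pole_order (idx j))%N := maxj k ck.
  apply: monomial_quot_nonunit => //; rewrite ltn_neqAle le andbT.
  apply: contra kj => /eqP; rewrite /pole_order /= => E.
  case: k j {ck cj maxj le} E => [k1 k2] [j1 j2] /= E.
  have E1 : k1 = j1.
    apply: ord_inj; rewrite -(modn_small (ltn_ord k1)) -(modn_small (ltn_ord j1)).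
    have md s i : (d * s + d.+1 * i = i %[mod d])%N.
      by rewrite mulSn addnCA -mulnDr addnC [(d * _)%N]mulnC modnMDl.
    by rewrite -(md k2) E md.
  apply/eqP; congr (_, _) => //; apply: ord_inj.
  by move: E; rewrite E1 => /eqP; rewrite eqn_add2r eqn_pmul2l // => /eqP.
rewrite RE (bigD1 j) //= mulrDr mulr1; congr (_ + _).
rewrite mulr_sumr; apply: eq_bigr => k _; rewrite rmorphM fmorphV.
have cj' : c (coef j) != 0 by rewrite fmorph_eq0; apply: cj.
by field; rewrite ?cj' ?m0.
Qed.

Lemma pole_of_x_unique O O' : closed_point c O -> closed_point c O' ->
  ~ O x -> ~ O' x -> forall f, O f -> O' f.
Proof.
move=> Oc Oc' Ox Ox' f Of.
have [Oring Oring'] := (closed_point_subring Oc, closed_point_subring Oc').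
have Oval g : g != 0 -> O g \/ O g^-1 by case: Oc => _ _ + _; apply.
have Oval' g : g != 0 -> O' g \/ O' g^-1 by case: Oc' => _ _ + _; apply.
have [->|f0] := eqVneq f 0; first exact: subring0.
have [P [Q [Q0 fE]]] := function_field.2 f.
have P0 : eval_xy c x y P != 0 by apply: contraNneq f0 => P0; rewrite fE P0 mul0r.
have [r [si [r0 HP]]] := leading_monomial P0.
have [s [ti [s0 HQ]]] := leading_monomial Q0.
have [le|lt] := leqP (pole_order si) (pole_order ti).
  have [e [ne PE]] := HP _ Oc' Ox'; have [e' [ne' QE]] := HQ _ Oc' Ox'.
  have [e0' Oe'] := unit1D Oring' Oval' ne'.
  have -> : f = c (r / s) * (monomial si / monomial ti) * (1 + e) * (1 + e')^-1.
    rewrite fE PE QE rmorphM fmorphV; field.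
    by rewrite e0' fmorph_eq0 s0 (monomial_neq0 Oc' Ox').
  apply: subringM => //; apply: subringM => //; last first.
    by apply: subringD => //; [apply: subring1|case: ne].
  by apply: subringM => //; [case: Oc'|apply: monomial_quot].
have [e [ne PE]] := HP _ Oc Ox; have [e' [ne' QE]] := HQ _ Oc Ox.
have [e0 Oe] := unit1D Oring Oval ne; have [e0' _] := unit1D Oring Oval ne'.
have : nonunit O f^-1; last by case=> _ /(_ f Of); rewrite mulVf.
have -> : f^-1 = c (s / r) * (1 + e') * (1 + e)^-1 * (monomial ti / monomial si).
  rewrite fE PE QE rmorphM fmorphV; field.
  by rewrite e0 e0' !fmorph_eq0 s0 r0 !(monomial_neq0 Oc Ox).
apply: nonunitM => //; last exact: monomial_quot_nonunit.
do ![apply: subringM => //]; first by case: Oc.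
by apply: subringD => //; [apply: subring1|case: ne'].
Qed.
End CurveAtInfinity.

(** * Gaps and expansions at infinity *)

Lemma laurentC_is_zmod_morphism (K : fieldType) : zmod_morphism (@laurentC K).
Proof. by move=> r s; rewrite /laurentC !rmorphB. Qed.

Lemma laurentC_is_monoid_morphism (K : fieldType) : monoid_morphism (@laurentC K).
Proof. by split=> [|r s]; rewrite /laurentC ?rmorph1 // !rmorphM. Qed.

HB.instance Definition _ (K : fieldType) := GRing.isZmodMorphism.Build K (laurent K)
  (@laurentC K) (@laurentC_is_zmod_morphism K).
HB.instance Definition _ (K : fieldType) := GRing.isMonoidMorphism.Build K (laurent K)
  (@laurentC K) (@laurentC_is_monoid_morphism K).

Section Infinity.
Context (K F : fieldType) (c : {rmorphism K -> F}) (x y : F) (a b d : nat).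
Hypothesis function_field : is_function_field c x y a b d.
Hypothesis d_gt1 : (1 < d)%N.
Hypothesis abd : (a + b = d.+1)%N.
Context (iota : {rmorphism F -> laurent K}).
Hypothesis iota_infty : expansion_at_infty c x y iota.
Implicit Types (f g h : F) (q : {poly K}).
Local Notation T := (laurentT K).
Local Notation z := (mpsX K (ord0 : 'I_1)).
Local Notation Oinf := (local_ring_infty iota).
Local Notation regular := (regular_off_infty c iota).

Let d_gt0 : (0 < d)%N := ltnW d_gt1.

Let iotaC r : iota (c r) = laurentC r. Proof. by case: iota_infty. Qed.
Let iota_y : iota y = T * iota x. Proof. by case: iota_infty. Qed.
Let Oinf_x : ~ Oinf x. Proof. by case: iota_infty. Qed.

Lemma closed_point_infty : closed_point c Oinf.
Proof.
split=> [r|f g [s fs] [t gt]|f f0|]; last by exists x.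
- by exists (mpsC 1 r); rewrite iotaC.
- by split; [exists (s - t); rewrite !rmorphB fs gt|exists (s * t); rewrite !rmorphM fs gt].
have := @laurent_factor K (iota f); rewrite fmorph_eq0 => /(_ f0).
case=> [[n [g [_ E]]]|[n [g [g0 E]]]]; first by left; exists (z ^+ n * g).
have [k gk] := mps_unit g0; right; exists (z ^+ n.+1 * k).
rewrite fmorphV E invfM -exprVn laurentTV rmorphM rmorphXn; congr (_ * _).
by rewrite -[LHS]mulr1 -(rmorph1 (@tofrac _)) -gk rmorphM mulKf // tofrac_eq0;
  apply: contraNneq g0 => ->; rewrite mps_coef0.
Qed.

Let Oring := closed_point_subring closed_point_infty.

Lemma x_neq0 : x != 0.
Proof. exact: pole_x_neq0 closed_point_infty Oinf_x. Qed.

Lemma regular_x : regular x.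
Proof.
move=> O Oc Oinf_neq; apply: contrapT => Ox; apply: Oinf_neq => h.
by split; apply: (pole_of_x_unique function_field d_gt0 abd) => //; apply: closed_point_infty.
Qed.

Lemma regularC r : regular (c r).
Proof. by move=> O [Or]. Qed.

Lemma regularB f g : regular f -> regular g -> regular (f - g).
Proof.
move=> Hf Hg O Oc Oneq; apply: subringB; [exact: closed_point_subring Oc| |];
by [apply: Hf|apply: Hg].
Qed.

Lemma regularM f g : regular f -> regular g -> regular (f * g).
Proof.
move=> Hf Hg O Oc Oneq; apply: subringM; [exact: closed_point_subring Oc| |];
by [apply: Hf|apply: Hg].
Qed.

Lemma regular_subring : subring_pred regular.
Proof.
split=> [|f g Hf Hg]; first by rewrite -(rmorph1 c); apply: regularC.
by split; [apply: regularB|apply: regularM].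
Qed.

Lemma regular_y : regular y.
Proof.
move=> O Oc Oneq; have Or := closed_point_subring Oc.
have Ox := regular_x Oc Oneq; have Ov : forall f, f != 0 -> O f \/ O f^-1 by case: Oc.
apply: (valuation_root Or Ov (n := d.-1)); rewrite prednK // (curve_eq function_field).
apply: subringM => //; apply: subringX => //; apply: subringB => //; exact: subring1.
Qed.

Lemma xV_infty : exists w : mps 1 K, [/\ w 0%MM = 0, iota x^-1 = tofrac w &
  T ^+ d = iota x * tofrac (1 - w) ^+ b].
Proof.
have [[w wE] wN] := nonunit_xV closed_point_infty Oinf_x.
exists w; split=> //.
  apply/eqP; apply: contrapT => /negP /mps_unit [k wk].
  apply: Oinf_x; exists k; apply: (mulfI (x := tofrac w)).
    by rewrite -wE fmorph_eq0 invr_eq0 x_neq0.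
  by rewrite -rmorphM wk -wE -rmorphM mulVf ?x_neq0 // !rmorph1.
have X0 : iota x != 0 by rewrite fmorph_eq0 x_neq0.
apply: (mulIf (expf_neq0 d X0)); rewrite -exprMn -iota_y -rmorphXn (curve_eq function_field).
rewrite rmorphM !rmorphXn rmorphB rmorph1 mulrAC -exprS -abd exprD -mulrA; congr (_ * _).
by rewrite -exprMn rmorphB rmorph1 /= -wE mulrBr mulr1 -rmorphM divff ?x_neq0 // rmorph1.
Qed.

Lemma x_infty : exists u : mps 1 K, iota x = T ^+ d * tofrac u.
Proof.
have [w [w0 _ Td]] := xV_infty.
have v0 : (1 - w) 0%MM != 0 by rewrite mps_coefB mps_coef1 eqxx w0 subr0 oner_neq0.
have [k vk] := mps_unit v0; exists (k ^+ b).
by rewrite Td -mulrA rmorphXn -exprMn -rmorphM vk rmorph1 expr1n mulr1.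
Qed.

Lemma Oinf_poly q h : Oinf h -> Oinf (map_poly c q).[h].
Proof.
move=> Oh; have [Oc _ _ _] := closed_point_infty.
rewrite horner_coef; apply: (subring_sum Oring) => i _.
by apply: (subringM Oring); [rewrite coef_map; apply: Oc|apply: (subringX Oring)].
Qed.

Lemma zero_at_infty_transcendental q h (g : mps 1 K) : h != 0 ->
  iota h = tofrac g -> g 0%MM = 0 -> (map_poly c q).[h] = 0 -> q = 0.
Proof.
move=> h0 hE g0; elim/poly_ind: q => // q r IH.
rewrite rmorphD rmorphM /= map_polyX map_polyC hornerD hornerMX hornerC /= => E.
have [G GE] := Oinf_poly q (ex_intro _ g hE).
have r0 : r = 0.
  have := congr1 iota E; rewrite rmorphD rmorphM rmorph0 iotaC hE GE -rmorphM -rmorphD.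
  move/eqP; rewrite tofrac_eq0 => /eqP /(congr1 (fun f : mps 1 K => f 0%MM)).
  by rewrite mps_coefD mps_coefM0 g0 mulr0 add0r mps_coef0 /= eqxx.
move: E; have -> : c r = 0 by rewrite r0 rmorph0.
rewrite r0 polyC0 !addr0 => /eqP; rewrite mulf_eq0 (negPf h0) orbF => /eqP /IH ->.
by rewrite mul0r.
Qed.

Lemma zero_at_infty_not_algebraic h (g : mps 1 K) : h != 0 ->
  iota h = tofrac g -> g 0%MM = 0 -> ~ algebraicOver c h.
Proof.
move=> h0 hE g0 [q q0 /eqP qh]; case/eqP: q0.
exact: zero_at_infty_transcendental hE g0 qh.
Qed.

(* A regular function vanishing at infinity has no poles; if it were nonzero,
   a valuation ring containing [1/h] but not [h] would be a pole. *)
Lemma regular_zero_at_infty h (g : mps 1 K) : regular h ->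
  iota h = tofrac g -> g 0%MM = 0 -> h = 0.
Proof.
move=> Rh hE g0; apply/eqP; apply: contrapT => /negP h0.
have halg := zero_at_infty_not_algebraic h0 hE g0.
pose S f := exists q, f = (map_poly c q).[h^-1].
have Sring : subring_pred S.
  split=> [|_ _ [q ->] [r ->]]; first by exists 1; rewrite rmorph1 hornerC.
  by split; [exists (q - r); rewrite rmorphB hornerD hornerN|
             exists (q * r); rewrite rmorphM hornerM].
have SV : S h^-1 by exists 'X; rewrite map_polyX hornerX.
have Sh : ~ S h.
  move=> [q qE]; apply: halg; rewrite -[h]invrK; apply: algebraic_inv.
  exists ('X * q - 1).
    apply/eqP => /(congr1 (fun r : {poly K} => r`_0)).
    by rewrite coefB coefXM coef1 coef0 sub0r => /eqP; rewrite oppr_eq0 oner_eq0.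
  rewrite /root rmorphB rmorphM rmorph1 /= map_polyX hornerD hornerN hornerM hornerX hornerC.
  by rewrite -qE mulVf // subrr.
have [O [Or SO Oh Ov]] := exists_valuation_ring Sring SV Sh.
have Oc : closed_point c O.
  split=> [r|f g' Of Og|f _|]; last by exists h.
  - by apply: SO; exists r%:P; rewrite map_polyC hornerC.
  - by split; [apply: subringB|apply: subringM].
  - exact: Ov.
by apply: (Oh); apply: Rh Oc _ => E; apply: (Oh); apply/E; exists g.
Qed.

Lemma regular_generated f (g : mps 1 K) : regular f -> iota f = T * tofrac g -> g 0%MM != 0 ->
  forall N h (g' : mps 1 K), regular h -> iota h = T ^+ N * tofrac g' ->
  exists q, (size q <= N.+1)%N /\ h = (map_poly c q).[f].
Proof.
move=> Rf fE g0; elim=> [|N IH] h g' Rh hE.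
  exists (g' 0%MM)%:P; split; first by rewrite size_polyC leq_b1.
  rewrite map_polyC hornerC /=; apply/eqP; rewrite -subr_eq0; apply/eqP.
  apply: (@regular_zero_at_infty _ (g' - mpsC 1 (g' 0%MM))).
  - by apply: regularB => //; apply: regularC.
  - by rewrite !rmorphB iotaC hE expr0 mul1r.
  - by rewrite mps_coefB /= eqxx subrr.
pose r := g' 0%MM / g 0%MM ^+ N.+1.
have Rr : regular (h - c r * f ^+ N.+1).
  apply: regularB => //; apply: regularM; first exact: regularC.
  exact: (subringX regular_subring).
have [] := @dvd_z _ (g' - mpsC 1 r * g ^+ N.+1).
  by rewrite mps_coefB mpsC_mulE mps_coefX0 divfK ?subrr // expf_neq0.
move=> g'' g''E; have [|q [sq hq]] := IH _ g'' Rr.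
  rewrite rmorphB rmorphM rmorphXn iotaC hE fE exprMn mulrCA -mulrBr.
  rewrite -[laurentC r]/(tofrac (mpsC 1 r)) -rmorphXn -rmorphM -rmorphB g''E rmorphM.
  by rewrite /= -laurentTV mulrA exprSr mulfK // laurentT_neq0.
exists (q + r *: 'X^(N.+1)); split.
  apply: leq_trans (size_polyD _ _) _; rewrite geq_max (leq_trans sq) //=.
  by apply: leq_trans (size_scale_leq _ _) _; rewrite size_polyXn.
rewrite rmorphD /= map_polyZ map_polyXn hornerD hornerZ hornerXn -hq.
by rewrite subrK.
Qed.

Section Genus.
Hypothesis char0 : forall n, n.+1%:R != 0 :> K.
Hypotheses (a_gt0 : (0 < a)%N) (b_gt0 : (0 < b)%N).
Hypotheses (coprime_ad : coprime a d) (coprime_bd : coprime b d).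

(* Otherwise [f] generates the regular functions and parametrizes the curve. *)
Lemma no_simple_pole f (g : mps 1 K) : regular f -> iota f = T * tofrac g -> g 0%MM = 0.
Proof.
move=> Rf fE; apply/eqP; apply: contrapT => /negP g0.
have gn0 : g != 0 by apply: contraNneq g0 => ->; rewrite mps_coef0.
have f0 : f != 0.
  by rewrite -(fmorph_eq0 iota) fE mulf_neq0 ?tofrac_eq0 // laurentT_neq0.
have [k gk] := mps_unit g0.
have fV : iota f^-1 = tofrac (z * k).
  rewrite fmorphV fE invfM laurentTV rmorphM; congr (_ * _).
  by rewrite -[LHS]mulr1 -(rmorph1 (@tofrac _)) -gk rmorphM mulKf // tofrac_eq0.
have falg : ~ algebraicOver c f.
  move=> /algebraic_inv; apply: zero_at_infty_not_algebraic fV _.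
    by rewrite invr_eq0.
  by rewrite mps_coefM0 mpsX_coef0 mul0r.
have [u xE] := x_infty.
have yE : iota y = T ^+ d.+1 * tofrac u by rewrite iota_y xE mulrA -exprS.
have [phi [sphi xphi]] := regular_generated Rf fE g0 regular_x xE.
have [psi [_ ypsi]] := regular_generated Rf fE g0 regular_y yE.
have rel : psi ^+ d = phi ^+ a * (phi - 1) ^+ b.
  apply/eqP; rewrite -subr_eq0; apply: contrapT => /negP q0; apply: falg.
  exists (psi ^+ d - phi ^+ a * (phi - 1) ^+ b) => //.
  rewrite /root rmorphB rmorphM !rmorphXn rmorphB rmorph1 /=.
  rewrite hornerD hornerN hornerM !horner_exp hornerD hornerN hornerC -xphi -ypsi.
  by rewrite (curve_eq function_field) subrr.
have := no_polynomial_parametrization char0 d_gt1 a_gt0 b_gt0 coprime_ad coprime_bd rel sphi.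
move/size1_polyC => phiC; apply: Oinf_x.
rewrite xphi phiC map_polyC hornerC /=; by have [] := closed_point_infty.
Qed.

Lemma gap1 : weierstrass_gap c iota 1.
Proof.
move=> f; rewrite /global_sections subrr expr1z expr0z; split=> -[Rf [g fE]]; split=> //.
  have [g' gE] := dvd_z (no_simple_pole Rf fE); exists g'.
  by rewrite fE gE rmorphM /= -laurentTV mulrA divff ?laurentT_neq0.
by exists (z * g); rewrite fE mul1r rmorphM /= -laurentTV mulrA divff ?laurentT_neq0 // mul1r.
Qed.

Lemma not_gap0 : ~ weierstrass_gap c iota 0.
Proof.
move=> /(_ 1) [H _]; case: H.
  split; first by rewrite -(rmorph1 c); apply: regularC.
  by exists 1; rewrite expr0z !rmorph1 mulr1.
move=> _ [g]; rewrite sub0r rmorph1 -invr_expz expr1z laurentTV -rmorphM.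
move/eqP; rewrite -(rmorph1 (@tofrac _)) tofrac_eq => /eqP /esym.
move/(congr1 (fun f : mps 1 K => f 0%MM)).
by rewrite mps_coefM0 mpsX_coef0 mul0r mps_coef1 eqxx => /esym/eqP; rewrite oner_eq0.
Qed.

Lemma first_gap mu : nth_gap c iota 1 mu <-> mu = 1%N.
Proof.
split=> [[Hmu]|->]; last first.
  split; first exact: gap1.
  rewrite 2!big_ord_recl big_ord0 asboolF; last exact: not_gap0.
  by rewrite asboolT //; apply: gap1.
case: mu Hmu => [/not_gap0 //|[//|mu]] Hmu.
rewrite big_ord_recr /= asboolT // addn1 => -[] /eqP.
rewrite sum_nat_eq0 => /forallP /(_ (Ordinal (isT : (1 < mu.+2)%N))) /=.
by rewrite asboolT //; apply: gap1.
Qed.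

Lemma expansion_coef_unique s (e e' : K) :
  in_A_plus_principal c iota (s - laurentC e * T) ->
  in_A_plus_principal c iota (s - laurentC e' * T) -> e = e'.
Proof.
move=> [f [g [Rf fE]]] [f' [g' [Rf' fE']]].
have E : iota (f' - f) = T * tofrac (mpsC 1 (e - e') - z * (z * (g' - g))).
  have -> : iota (f' - f) =
     (s - laurentC e' * T) - (s - laurentC e * T) - T^-1 * tofrac (g' - g).
    by rewrite fE fE' !rmorphB; ring.
  have -> : tofrac (mpsC 1 (e - e') - z * (z * (g' - g))) =
     laurentC e - laurentC e' - T^-1 * (T^-1 * tofrac (g' - g)).
    by rewrite rmorphB !rmorphM /= -laurentTV -(rmorphB (@laurentC K)).
  have identity (L : fieldType) (t s1 r r' u : L) : t != 0 ->
    s1 - r' * t - (s1 - r * t) - t^-1 * u = t * (r - r' - t^-1 * (t^-1 * u)).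
    by move=> t0; field.
  exact/identity/laurentT_neq0.
have := no_simple_pole (regularB Rf' Rf) E.
rewrite mps_coefB mps_coefM0 mpsX_coef0 mul0r subr0 /= eqxx => /eqP.
by rewrite subr_eq0 => /eqP.
Qed.
End Genus.

(* [T^d = x (1 - 1/x)^b], so [T^(dn+1)] is [T] times a Laurent polynomial in [x]:
   its positive part yields a polynomial multiple of [y = T x], its negative part
   is principal, and the constant term gives the coefficient of [T]. *)
Lemma expansion_power n : (0 < b)%N ->
  in_A_plus_principal c iota
    (T ^+ (d * n).+1 - laurentC ((-1) ^+ n *+ 'C(b * n, n)) * T).
Proof.
move=> b0; have [w [w0 wE Td]] := xV_infty.
pose t j : K := (-1) ^+ j *+ 'C(b * n, j).
have X0 : iota x != 0 by rewrite fmorph_eq0 x_neq0.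
have wX : tofrac w = (iota x)^-1 by rewrite -wE fmorphV.
have wz : w = z ^+ d * (1 - w) ^+ b.
  apply: tofrac_inj; rewrite rmorphM !rmorphXn /= -laurentTV wX exprVn Td.
  have v0 : tofrac (1 - w) != 0.
    rewrite tofrac_eq0; apply/eqP => /(congr1 (fun f : mps 1 K => f 0%MM)).
    by rewrite mps_coefB mps_coef1 eqxx w0 subr0 mps_coef0 => /eqP; rewrite oner_eq0.
  by rewrite invfM mulfVK // expf_neq0.
have expand : T ^+ (d * n) =
    \sum_(0 <= j < (b * n).+1) laurentC (t j) * (iota x ^+ n * tofrac w ^+ j).
  rewrite exprM Td exprMn -exprM rmorphB rmorph1 exprBn mulr_sumr big_mkord.
  apply: eq_bigr => j _; rewrite expr1n mulr1 /t rmorphMn rmorphXn rmorphN rmorph1 /=.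
  by rewrite mulrnAr mulrnAl mulrCA.
have nbn : (n < (b * n).+1)%N by rewrite ltnS leq_pmull.
pose f := (\sum_(0 <= j < n) c (t j) * x ^+ (n - j.+1)) * y.
pose g := z ^+ d.-2 * (1 - w) ^+ b *
  \sum_(n.+1 <= j < (b * n).+1) mpsC 1 (t j) * w ^+ (j - n.+1).
have XW k : iota x ^+ k * tofrac w ^+ k = 1 by rewrite wX -exprMn divff // expr1n.
have low : \sum_(0 <= j < n) laurentC (t j) * (iota x ^+ n * tofrac w ^+ j) * T = iota f.
  rewrite /f rmorphM rmorph_sum iota_y mulr_suml; apply: eq_big_nat => j /andP [_ jn].
  have -> : iota x ^+ n * tofrac w ^+ j = iota x ^+ (n - j.+1) * iota x.
    by rewrite -{1}(subnK jn) exprD exprS -!mulrA XW mulr1.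
  by rewrite rmorphM rmorphXn /= iotaC [T * _]mulrC !mulrA.
have WT : tofrac w * T = T^-1 * tofrac (z ^+ d.-2 * (1 - w) ^+ b).
  have identity (L : fieldType) (u q v : L) : u != 0 ->
    u^-1 ^+ 2 * q * v * u = u^-1 * (q * v) by move=> u0; field.
  have wz2 : w = z ^+ 2 * z ^+ d.-2 * (1 - w) ^+ b.
    by rewrite -exprD (_ : (2 + d.-2)%N = d); [exact: wz|lia].
  have -> : tofrac w = T^-1 ^+ 2 * tofrac (z ^+ d.-2) * tofrac ((1 - w) ^+ b).
    by rewrite laurentTV -rmorphXn -!rmorphM /= -wz2.
  by rewrite [in RHS]rmorphM; apply/identity/laurentT_neq0.
have high : \sum_(n.+1 <= j < (b * n).+1) laurentC (t j) * (iota x ^+ n * tofrac w ^+ j) * T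
    = T^-1 * tofrac g.
  rewrite /g rmorphM rmorph_sum mulrA -WT [RHS]mulrC mulr_suml.
  apply: eq_big_nat => j /andP [nj _].
  have -> : iota x ^+ n * tofrac w ^+ j = tofrac w ^+ (j - n.+1) * tofrac w.
    by rewrite -{1}(subnK nj) exprD exprSr mulrCA [iota x ^+ n * (_ * _)]mulrA XW mul1r.
  by rewrite rmorphM rmorphXn /= -[tofrac (mpsC 1 _)]/(laurentC _) !mulrA.
exists f, g; split.
  apply: regularM; last exact: regular_y.
  apply: (subring_sum regular_subring) => j _; apply: regularM; first exact: regularC.
  by apply: (subringX regular_subring); apply: regular_x.
rewrite exprSr expand (big_cat_nat (leq0n n) (ltnW nbn)) /= [X in (_ + X) * T]big_ltn //=.
rewrite XW mulr1 -low -high -!mulr_suml !mulrDl.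
by rewrite addrCA [LHS]addrC addKr.
Qed.
End Infinity.

Lemma padic_num_char0 (p : nat) (p_pr : prime p) n : n.+1%:R != 0 :> padic_num p_pr.
Proof. by rewrite -(rmorph_nat (@tofrac _)) tofrac_eq0 padic_nat_neq0. Qed.

Local Close Scope ring_scope.

Theorem proposition5p3 (p d a b : nat) (p_pr : prime p)
    (d_pr : prime d) (d_odd : odd d) (p_mod_d : p = 1 %[mod d])
    (a_gt1 : 1 < a) (a_ltd : a < d) (def_b : b = d + 1 - a)
    (F : fieldType) (c : {rmorphism padic_num p_pr -> F}) (x y : F)
    (F_function_field : is_function_field c x y a b d)
    (iota : {rmorphism F -> laurent (padic_num p_pr)})
    (iota_infty : expansion_at_infty c x y iota) :
  (exists J : mps 2 (padic_int p_pr), is_hatJ c iota 1 J) /\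
  (exists L : mps 2 (padic_int p_pr),
     [/\ formal_group_law L,
         is_logarithm L (l1 p_pr b d)
       & forall J : mps 2 (padic_int p_pr),
           is_hatJ c iota 1 J -> formal_group_iso L J]).
Proof.
have [b_gt0 b_ltd abd] : [/\ 0 < b, b < d & a + b = d.+1] by split; lia.
have d_gt1 := prime_gt1 d_pr; have d_gt0 := ltnW d_gt1.
have coprime_d t : 0 < t -> t < d -> coprime t d.
  by move=> t0 td; rewrite coprime_sym prime_coprime // gtnNdvd.
have char0 := padic_num_char0 p_pr.
pose n k := (p ^ k - 1) %/ d.
have pk_gt0 k : 0 < p ^ k by rewrite expn_gt0 prime_gt0.
have pkE k : p ^ k = (d * n k).+1.
  have dv : d %| p ^ k - 1 by rewrite -eqn_mod_dvd // -modnXm p_mod_d modnXm exp1n.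
  by rewrite mulnC divnK // subn1 prednK.
have p_odd : odd p.
  have [p2|//] := even_prime p_pr; move: p_mod_d; rewrite p2 !modn_small //.
  by apply: leq_ltn_trans a_ltd.
have n_even k : ~~ odd (n k).
  have := congr1 odd (pkE k); rewrite oddX p_odd orbT /= oddM d_odd /=.
  by case: (odd (n k)).
pose e k : padic_int p_pr := ('C(n k * b, n k)%:R)%R.
have l1E : l1 p_pr b d = p_power_series p (fun k => tofrac (e k)).
  by congr p_power_series; apply/funext => k; rewrite rmorph_nat.
have e0 : e 0 = 1%R by rewrite /e /n expn0 subnn div0n mul0n bin0.
have expansion k : in_A_plus_principal c iota
   (laurentT _ ^+ (p ^ k) - laurentC (tofrac (e k)) * laurentT _)%R.
  have := expansion_power F_function_field d_gt1 abd iota_infty (n k) b_gt0.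
  rewrite -pkE -signr_odd (negPf (n_even k)) expr0 mulnC /e.
  by rewrite -(rmorph_nat (@tofrac _)).
have [u Hu] := binomial_padic_ratio p_pr d_gt0 (introT andP (conj b_gt0 b_ltd)) p_mod_d.
have p_neq0 : (p%:R != 0 :> padic_int p_pr)%R.
  by have := padic_nat_neq0 p_pr p.-1; rewrite prednK ?prime_gt0.
have [L [Lgroup Llog]] := integral_formal_group p_pr p_neq0
  (@padic_fermat p p_pr) e0 Hu.
have gap := first_gap F_function_field d_gt1 abd iota_infty char0
  (ltnW a_gt1) b_gt0 (coprime_d a (ltnW a_gt1) a_ltd) (coprime_d b b_gt0 b_ltd).
split.
  exists L, 1, e; split=> // [|k]; first exact/gap.
  by rewrite mul1n expr1.
exists L; split=> //; first by rewrite l1E.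
move=> J [mu [e' [/gap -> e'E Jgroup Jlog]]].
have ee' k : tofrac (e' k) = tofrac (e k).
  apply: (expansion_coef_unique F_function_field d_gt1 abd iota_infty char0
    (ltnW a_gt1) b_gt0 (coprime_d a (ltnW a_gt1) a_ltd) (coprime_d b b_gt0 b_ltd) _ (expansion k)).
  by have := e'E k; rewrite mul1n expr1.
have Llog' : is_logarithm L (p_power_series p (fun k => tofrac (e' k))).
  by rewrite (_ : (fun k => tofrac (e' k)) = fun k => tofrac (e k)) //; apply/funext.
have J0 := formal_group_law_coef0 Jgroup; have L0 := formal_group_law_coef0 Lgroup.
have -> : J = L.
  apply: (logarithm_unique p_pr (c := fun k => tofrac (e' k))) => //.
  by rewrite ee' e0 rmorph1.
exact: formal_group_iso_refl.
Qed.
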